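(* The set of co-Hopfian groups $\{G \in \mathrm{NiGp}(2)_\omega : \text{every injective endomorphism of } G \text{ is surjective}\}$ is a complete co-analytic subset of $\mathrm{NiGp}(2)_\omega$.
   Context: $\mathrm{NiGp}(2)_\omega$ is the Borel space of nilpotent groups of class $2$ with domain $\omega = \mathbb{N}$: the set of all such group structures with underlying set $\omega$, with the standard Borel structure inherited from the usual product space of structures with domain $\omega$ in the language of groups. A group $G$ is called co-Hopfian if every one-to-one endomorphism of $G$ is onto. A subset $A$ of a standard Borel space $Z$ is complete co-analytic in $Z$ if $A$ is co-analytic and for every standard Borel space $Y$ and every co-analytic $B \subseteq Y$ there is a Borel function $F : Y \to Z$ such that $B = F^{-1}(A)$. *)

(* Defs.v *)
From mathcomp Require Import all_boot all_order all_algebra.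
From mathcomp Require Import all_classical all_reals all_analysis.

Set Implicit Arguments.
Unset Strict Implicit.
Unset Printing Implicit Defensive.

Local Open Scope classical_set_scope.

(* A measurable space is given here as a type with a set of subsets, not as a
   [measurableType]: the latter is pointed, which would exclude the empty
   standard Borel space and require a distinguished element of every space. *)

Definition borel_sets (T : topologicalType) : set (set T) := <<s @open T >>.

(* A Polish space, presented through one of its complete metrics; completeness
   is not taken from [completeType], which is pointed. *)
Definition polish (R : realType) (M : metricType R) : Prop :=
  (exists2 D : set M, countable D & dense D) /\
  (forall F : set_system M, ProperFilter F -> cauchy F ->
     exists x : M, F --> x).

(* [h] is an isomorphism of measurable spaces from [(Z, S)] to [T] with its
   Borel sets. *)
Definition borel_isomorphism (Z : Type) (S : set (set Z)) (T : topologicalType)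
    (h : Z -> T) : Prop :=
  bijective h /\ (forall B : set T, borel_sets B <-> S (h @^-1` B)).

Definition standard_borel (R : realType) (Z : Type) (S : set (set Z)) : Prop :=
  exists (M : metricType R) (h : Z -> M), polish M /\ borel_isomorphism S h.

Definition polish_analytic (R : realType) (M : metricType R) (A : set M) :
    Prop :=
  exists (N : metricType R) (f : N -> M),
    [/\ polish N, continuous f & range f = A].

(* As in Kechris, Classical Descriptive Set Theory, section 14: a subset of a
   standard Borel space is analytic when some Borel isomorphism onto a Polish
   space carries it to an analytic set (equivalently, when all of them do). *)
Definition analytic (R : realType) (Z : Type) (S : set (set Z)) (A : set Z) :
    Prop :=
  exists (M : metricType R) (h : Z -> M),
    [/\ polish M, borel_isomorphism S h & polish_analytic (h @` A)].

Definition coanalytic (R : realType) (Z : Type) (S : set (set Z)) (A : set Z) :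
    Prop :=
  analytic R S (~` A).

Definition borel_function (Y : Type) (SY : set (set Y)) (Z : Type)
    (SZ : set (set Z)) (F : Y -> Z) : Prop :=
  forall B : set Z, SZ B -> SY (F @^-1` B).

Definition complete_coanalytic (R : realType) (Z : Type) (S : set (set Z))
    (A : set Z) : Prop :=
  [/\ standard_borel R S,
      coanalytic R S A
    & forall (Y : Type) (SY : set (set Y)) (B : set Y),
        standard_borel R SY -> coanalytic R SY B ->
        exists F : Y -> Z, borel_function SY S F /\ B = F @^-1` A].

(* The structures with domain nat in the language (mul, inv, one) of groups,
   with the product topology (nat being discrete). *)
Definition group_structure : Type :=
  ({ptws nat * nat -> nat} * {ptws nat -> nat} * nat)%type.

Section Structure.
Variable G : group_structure.

Definition gmul (x y : nat) : nat := G.1.1 (x, y).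
Definition ginv (x : nat) : nat := G.1.2 x.
Definition gone : nat := G.2.

Definition is_group : Prop :=
  [/\ associative gmul, left_id gone gmul, right_id gone gmul,
      left_inverse gone ginv gmul & right_inverse gone ginv gmul].

Definition is_subgroup (H : set nat) : Prop :=
  [/\ H gone, forall x y, H x -> H y -> H (gmul x y)
    & forall x, H x -> H (ginv x)].

Definition generated_subgroup (A : set nat) : set nat := smallest is_subgroup A.

Definition commutator (x y : nat) : nat :=
  gmul (gmul (ginv x) (ginv y)) (gmul x y).

(* [lower_central i] is the term usually written gamma_(i+1). *)
Fixpoint lower_central (i : nat) : set nat :=
  if i is j.+1 then
    generated_subgroup [set commutator x y | x in lower_central j & y in setT]
  else setT.

(* The nilpotency class is exactly [c]. *)
Definition nilpotent_of_class (c : nat) : Prop :=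
  lower_central c = [set gone] /\
  (forall i, (i < c)%N -> lower_central i <> [set gone]).

Definition co_hopfian : Prop :=
  forall f : nat -> nat,
    {morph f : x y / gmul x y} -> injective f -> forall y, exists x, f x = y.

End Structure.

(* As a type, [NiGp c] carries the subspace topology of [set_type]. *)
Definition NiGp (c : nat) : set group_structure :=
  [set G | is_group G /\ nilpotent_of_class G c].

(* Main.v *)
Require Import Defs.
From HB Require Import structures.
From mathcomp Require Import all_boot all_order all_algebra.
From mathcomp Require Import all_classical all_reals all_analysis.
From mathcomp Require Import ring lra.

(** Co-Hopfian groups form a co-analytic set because a failure is witnessed by an
    injective endomorphism f and a point y missed by f, and the triples (G, f, y)
    form a Polish space: each is a sequence of natural numbers, and the conditions
    are closed ([embedding_coords_closed]). The only condition that is not closed on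
    the nose is that the class is not less than two; recording the first pair of
    noncommuting elements among the coordinates of G repairs this
    ([coords_closed]), and gives the standard Borel structure of the space as well.

    For completeness, a co-analytic set B of Y is first written as the set of the y
    without infinite path s 0, s 1, ... in a strict order on the natural numbers
    restricted to a set of nodes depending measurably on y
    ([coanalytic_paths]). Let [D x y] be the corresponding reflexive and transitive
    relation. It is coded into a group as follows.

    Let V be the space of polynomials over the rationals, with basis e_y = 'X^y, and
    let H be the Heisenberg group on Q x V x V, with product
    (a, v, z)(b, w, t) = (a + b, v + w, z + t + a w). Let R_y be the ring of the
    rationals whose denominator avoids one reserved prime and the primes p_x such
    that [D x y] fails. The group is the quotient G of H by the central subgroup
    N = sum of the R_y e_y.

    An injective endomorphism of G preserves the torsion subgroup, which is the
    centre V / N. The induced map on Q x V is linear; it preserves the plane V,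
    which contains every commuting subspace of dimension at least two, and commutators
    then show that the map on the centre is induced by an injective linear map
    theta of V preserving N ([endo_linear_part]). As e_x is infinitely p_x-divisible
    in N, theta e_x is a combination of the e_y with [D x y]
    ([lattice_endo_support]). If there is no infinite path, induction shows that
    theta is onto ([lattice_endo_surj]), and so is the endomorphism ([endo_surj]).
    If s is an infinite path, then sending e_(s n) to e_(s n) + e_(s n.+1) and
    fixing the other e_y defines an injective endomorphism which misses e_(s 0)
    ([path_endo]).

    The group G has to be placed on the natural numbers in a Borel way. The classes
    of the countable group H modulo N are numbered by their least codes
    ([quotient_enumeration]); as membership in N is a countable combination of
    measurable conditions on y, the multiplication table is measurable in y. *)

Set Implicit Arguments.
Unset Strict Implicit.
Unset Printing Implicit Defensive.

Import Order.TTheory GRing.Theory Num.Theory.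
Local Open Scope classical_set_scope.

(** * Countable logic in a sigma-algebra *)

(** Membership in a sigma-algebra is stable under the first-order connectives and
    countable quantifiers, so a set defined by such a formula is measurable by
    inspection. *)
Section MeasurableLogic.
Variables (Y : Type) (S : set (set Y)).
Hypothesis S_sigma : sigma_algebra setT S.

Lemma measN (P : Y -> Prop) : S P -> S (fun y => ~ P y).
Proof. by case: S_sigma => _ + _ => /[apply]; rewrite setTD. Qed.

Lemma meas_ex (I : countType) (P : I -> Y -> Prop) :
  (forall i, S (P i)) -> S (fun y => exists i, P i y).
Proof.
move=> SP; case: S_sigma => S0 _ SU.
have := SU (fun n => if unpickle n is Some i then P i else set0).
rewrite (_ : \bigcup_k _ = (fun y => exists i, P i y)).
  by apply=> n; case: unpickle.
apply/seteqP; split=> [y [n _]|y [i Py]].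
  by case: unpickle => // i; exists i.
by exists (pickle i); rewrite ?pickleK.
Qed.

Lemma meas_all (I : countType) (P : I -> Y -> Prop) :
  (forall i, S (P i)) -> S (fun y => forall i, P i y).
Proof.
move=> SP; rewrite (_ : (fun y => _) = (fun y => ~ exists i, ~ P i y)).
  by apply: measN; apply: meas_ex => i; apply: measN.
apply/funext => y; apply/propext; split=> [Py [i]|nPy i]; first exact.
by apply: contrapT => nPi; apply: nPy; exists i.
Qed.

Lemma meas_const (p : Prop) : S (fun=> p).
Proof.
have S0 : S set0 by case: S_sigma.
have [Hp|np] := pselect p; last first.
  by rewrite (_ : (fun=> p) = set0)//; apply/seteqP; split.
rewrite (_ : (fun=> p) = (fun y => ~ set0 y)); first exact: measN.
by apply/seteqP; split=> // y _ [].
Qed.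

Lemma meas_and (P Q : Y -> Prop) : S P -> S Q -> S (fun y => P y /\ Q y).
Proof.
move=> SP SQ.
rewrite (_ : (fun y => _) = (fun y => forall b : bool, if b then P y else Q y)).
  by apply: meas_all => -[].
apply/seteqP; split=> [y [Py Qy] []//|y h].
by split; [apply: (h true)|apply: (h false)].
Qed.

Lemma meas_imply (P Q : Y -> Prop) : S P -> S Q -> S (fun y => P y -> Q y).
Proof.
move=> SP SQ; rewrite (_ : (fun y => _) = (fun y => ~ (P y /\ ~ Q y))).
  by apply: measN; apply: meas_and => //; apply: measN.
apply/seteqP; split=> [y PQ [/PQ]//|y h Py].
by apply: contrapT => nQ; apply: h.
Qed.

(** For countable T this is measurability with respect to all subsets of T. *)
Definition fiber_measurable (T : Type) (g : Y -> T) := forall t, S (fun y => g y = t).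

Lemma fiber_meas_const T (t : T) : fiber_measurable (fun=> t).
Proof. by move=> u; apply: meas_const. Qed.

Lemma meas_subst (I : countType) (a : Y -> I) (P : I -> Y -> Prop) :
  fiber_measurable a -> (forall i, S (P i)) -> S (fun y => P (a y) y).
Proof.
move=> ma SP; rewrite (_ : (fun y => _) = (fun y => exists i, a y = i /\ P i y)).
  by apply: meas_ex => i; apply: meas_and.
by apply/seteqP; split=> [y Py|y [i [->]]//]; exists (a y).
Qed.

Lemma fiber_meas_subst (I : countType) T (a : Y -> I) (g : I -> Y -> T) :
  fiber_measurable a -> (forall i, fiber_measurable (g i)) ->
  fiber_measurable (fun y => g (a y) y).
Proof.
move=> ma mg t; apply: (meas_subst (P := fun i y => g i y = t)) => // i.
exact: mg.
Qed.

Lemma fiber_meas_comp (I : countType) T (a : Y -> I) (f : I -> T) :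
  fiber_measurable a -> fiber_measurable (fun y => f (a y)).
Proof.
move=> ma; apply: (fiber_meas_subst (g := fun i _ => f i)) => // i.
exact: fiber_meas_const.
Qed.

Lemma fiber_meas_comp2 (I J : countType) T (a : Y -> I) (b : Y -> J) (f : I -> J -> T) :
  fiber_measurable a -> fiber_measurable b -> fiber_measurable (fun y => f (a y) (b y)).
Proof.
move=> ma mb; apply: (fiber_meas_subst (g := fun i y => f i (b y))) => // i.
exact: fiber_meas_comp.
Qed.

Lemma fiber_meas_asbool (P : Y -> Prop) : S P -> fiber_measurable (fun y => `[<P y>]).
Proof.
move=> SP b; case: b.
  by rewrite (_ : (fun y => _) = P)//; apply/seteqP; split=> y /asboolP.
rewrite (_ : (fun y => _) = (fun y => ~ P y)); first exact: measN.
by apply/seteqP; split=> y; [move=> /negbT/asboolPn|move=> /asboolPn/negbTE].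
Qed.

(** The classes of a measurable family of equivalence relations on a countable set
    are numbered in a measurable way: each class is represented by its least code,
    and the number of a class counts the smaller representatives. *)
Section QuotientEnumeration.
Variables (K : countType) (eqv : Y -> K -> K -> Prop) (rep : nat -> K).
Hypothesis eqv_refl : forall y h, eqv y h h.
Hypothesis eqv_sym : forall y g h, eqv y g h -> eqv y h g.
Hypothesis eqv_trans : forall y g h k, eqv y g h -> eqv y h k -> eqv y g k.
Hypothesis eqv_meas : forall g h, S (fun y => eqv y g h).
Hypothesis eqv_infinite : forall y i j, eqv y (rep i) (rep j) -> i = j.

Let hit y h n := exists k, pickle k = n /\ eqv y k h.

Let hit_ex y h : exists n, `[<hit y h n>].
Proof. by exists (pickle h); apply/asboolP; exists h. Qed.

Definition class_code y h := ex_minn (hit_ex y h).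

Lemma class_codeP y h : hit y h (class_code y h).
Proof. by rewrite /class_code; case: ex_minnP => n /asboolP. Qed.

Lemma class_code_min y h n : hit y h n -> (class_code y h <= n)%N.
Proof. by rewrite /class_code; case: ex_minnP => m _ + /asboolP; apply. Qed.

Lemma class_codeE y g h : class_code y g = class_code y h <-> eqv y g h.
Proof.
split=> [e|e]; last first.
  apply/eqP; rewrite eqn_leq; apply/andP; split; apply: class_code_min.
    have [k [kE kh]] := class_codeP y h; exists k; split=> //.
    exact: eqv_trans kh (eqv_sym e).
  have [k [kE kh]] := class_codeP y g; exists k; split=> //.
  exact: eqv_trans kh e.
have [k [kE kg]] := class_codeP y g; have [l [lE lh]] := class_codeP y h.
have kl : k = l by apply: (pcan_inj pickleK); rewrite kE lE.
by apply: eqv_trans (eqv_sym kg) _; rewrite kl.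
Qed.

Lemma class_code_meas h : fiber_measurable (class_code^~ h).
Proof.
have hm n : S (fun y => hit y h n).
  by apply: meas_ex => k; apply: meas_and => //; apply: meas_const.
move=> n; rewrite (_ : (fun y => _) =
  (fun y => hit y h n /\ forall m, hit y h m -> (n <= m)%N)).
  apply: meas_and => //; apply: meas_all => m; apply: meas_imply => //.
  exact: meas_const.
apply/seteqP; split=> [y /= <-|y [hn min]/=].
  by split=> [|m]; [exact: class_codeP|exact: class_code_min].
by apply/eqP; rewrite eqn_leq class_code_min// min//; apply: class_codeP.
Qed.

Definition is_code y n := `[<exists k, pickle k = n /\ class_code y k = n>].

Lemma is_code_class y h : is_code y (class_code y h).
Proof.
apply/asboolP; have [k [kE kh]] := class_codeP y h.
by exists k; split=> //; apply/class_codeE.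
Qed.

Definition class_index y h := count (is_code y) (iota 0 (class_code y h)).

Let cnt y n := count (is_code y) (iota 0 n).

Let cntS y n : cnt y n.+1 = (cnt y n + is_code y n)%N.
Proof. by rewrite /cnt -addn1 iotaD count_cat /= addn0. Qed.

Let cnt_le y m n : (m <= n)%N -> (cnt y m <= cnt y n)%N.
Proof.
move=> /subnK <-; elim: (n - m)%N => // k IH.
by rewrite addSn cntS (leq_trans IH)// leq_addr.
Qed.

Lemma class_indexE y g h : class_index y g = class_index y h <-> eqv y g h.
Proof.
split=> [|/class_codeE e]; last by rewrite /class_index e.
have lt a b : (class_code y a < class_code y b)%N ->
    (cnt y (class_code y a) < cnt y (class_code y b))%N.
  by move=> /(cnt_le y); apply: leq_trans; rewrite cntS is_code_class addn1.
move=> e; apply/class_codeE.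
case: (ltngtP (class_code y g) (class_code y h)) => // /lt;
  by move: e; rewrite /class_index /cnt => ->; rewrite ltnn.
Qed.

(** The least m such that the first m codes contain n + 1 representatives ends with
    the representative numbered n. *)
Lemma class_index_surj y n : exists h, class_index y h = n.
Proof.
have [m nm] : exists m, (n < cnt y m)%N.
  pose c i := class_code y (rep i).
  exists (\max_(i < n.+1) (c i).+1)%N; rewrite /cnt -size_filter.
  have {1}<- : size (map c (iota 0 n.+1)) = n.+1 by rewrite size_map size_iota.
  apply: uniq_leq_size.
    rewrite map_inj_uniq ?iota_uniq// => i j /class_codeE; exact: eqv_infinite.
  move=> k /mapP[i]; rewrite mem_iota add0n /= => lin ->.
  rewrite mem_filter is_code_class/= mem_iota add0n /=.
  exact: (@leq_bigmax _ (fun i : 'I_n.+1 => (c i).+1) (Ordinal lin)).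
elim: m nm => // m IH; rewrite cntS; have [/IH//|le] := ltnP n (cnt y m).
case cm: (is_code y m); last by rewrite addn0 ltnNge le.
rewrite addn1 ltnS => ge; move/asboolP: cm => [k [_ ck]].
by exists k; rewrite /class_index ck; apply/eqP; rewrite eqn_leq le.
Qed.

Lemma class_index_meas h : fiber_measurable (class_index^~ h).
Proof.
apply: (fiber_meas_subst (g := fun n y => cnt y n)); first exact: class_code_meas.
elim=> [|n IH]; first exact: fiber_meas_const.
rewrite (_ : (fun y => _) = (fun y => cnt y n + is_code y n)%N); last first.
  by apply/funext => y; apply: cntS.
apply: (fiber_meas_comp2 (fun i (b : bool) => (i + b)%N)) => //.
apply: fiber_meas_asbool; apply: meas_ex => k.
by apply: meas_and; [apply: meas_const|apply: class_code_meas].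
Qed.

Lemma quotient_enumeration : exists (en : Y -> nat -> K) (idx : Y -> K -> nat),
  [/\ forall y g h, idx y g = idx y h <-> eqv y g h,
      forall y n, idx y (en y n) = n,
      forall h, fiber_measurable (idx^~ h) & forall n, fiber_measurable (en^~ n)].
Proof.
have /choice[en enP] (yn : Y * nat) : exists k,
    class_index yn.1 k = yn.2 /\ class_code yn.1 k = pickle k.
  have [h hn] := class_index_surj yn.1 yn.2.
  have [k [kE kh]] := class_codeP yn.1 h; exists k; split.
    by rewrite -hn; apply/class_indexE.
  by rewrite kE; apply/class_codeE.
exists (fun y n => en (y, n)), class_index; split.
- exact: class_indexE.
- by move=> y n; have [] := enP (y, n).
- exact: class_index_meas.
- move=> n k; rewrite (_ : (fun y => _) =
    (fun y => class_index y k = n /\ class_code y k = pickle k)).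
    by apply: meas_and; [apply: class_index_meas|apply: class_code_meas].
  apply/seteqP; split=> [y /= <-|y [kn kc]/=]; first exact: enP (y, n).
  have [en1 en2] := enP (y, n); apply: (pcan_inj pickleK).
  by rewrite -en2 -kc; apply/class_codeE/class_indexE; rewrite en1 kn.
Qed.
End QuotientEnumeration.
End MeasurableLogic.

(** * Lattices in the rational polynomials *)

Local Open Scope ring_scope.

Definition p_integral (p : nat) (b : rat) : Prop :=
  exists n : nat, ~~ (p %| n)%N /\ b * n%:R \is a Num.int.

Lemma p_integral0 p : prime p -> p_integral p 0.
Proof. by move=> pp; exists 1%N; rewrite mul0r Euclid_dvd1. Qed.

Lemma p_integralN p b : p_integral p b -> p_integral p (- b).
Proof. by case=> n [pn bn]; exists n; split; rewrite // mulNr rpredN. Qed.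

Lemma p_integralD p b c : prime p ->
  p_integral p b -> p_integral p c -> p_integral p (b + c).
Proof.
move=> pp [n [pn bn]] [m [pm cm]]; exists (n * m)%N.
rewrite Euclid_dvdM// negb_or pn pm; split=> //.
rewrite natrM mulrDl rpredD//; first by rewrite mulrA rpredM ?rpred_nat.
by rewrite mulrCA rpredM ?rpred_nat.
Qed.

Lemma p_integral_expV p q k : prime p -> prime q -> p != q ->
  p_integral p (q%:R ^- k).
Proof.
move=> pp pq neq; exists (q ^ k)%N.
rewrite Euclid_dvdX// negb_and dvdn_prime2// neq; split=> //.
by rewrite natrX mulVf ?rpred1// expf_neq0// pnatr_eq0 -lt0n prime_gt0.
Qed.

Lemma p_integral_int p b : prime p -> b \is a Num.int -> p_integral p b.
Proof. by move=> pp bi; exists 1%N; rewrite mulr1 Euclid_dvd1. Qed.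

(** The numerator of a nonzero such b would be divisible by every power of p. *)
Lemma p_integral_divisible_eq0 p b : prime p ->
  (forall k, p_integral p (b * p%:R ^- k)) -> b = 0.
Proof.
move=> pp ib; apply/eqP/negPn/negP => b0.
have nb0 : (0 < `|numq b|)%N by rewrite absz_gt0 numq_eq0.
have [n [pn /intrP[m mE]]] := ib `|numq b|%N.
suff : (p ^ `|numq b| %| `|numq b|)%N.
  by move/(dvdn_leq nb0); rewrite leqNgt ltn_expl// prime_gt1.
rewrite -(@Gauss_dvdl _ _ n); last by rewrite coprimeXl// prime_coprime.
have p0 : p%:R ^+ `|numq b| != 0 :> rat.
  by rewrite expf_neq0// pnatr_eq0 -lt0n prime_gt0.
have : numq b * n%:Z = m * denq b * (p ^ `|numq b|)%:Z.
  apply: (@intr_inj rat); rewrite !rmorphM/= -mE -pmulrn.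
  rewrite numqE (_ : (p ^ _)%N%:~R = p%:R ^+ `|numq b|) -?natrX//.
  by rewrite natrX; field.
move/(congr1 absz); rewrite !abszM !absz_nat => ->.
exact: dvdn_mull.
Qed.

Fixpoint nth_prime (n : nat) : nat :=
  if n is m.+1 then s2val (prime_above (nth_prime m)) else 2%N.

Lemma nth_primeP n : prime (nth_prime n).
Proof. by case: n => //= n; case: (prime_above _). Qed.

Lemma ltn_nth_prime m n : (m < n)%N -> (nth_prime m < nth_prime n)%N.
Proof.
elim: n => //= n IH; rewrite ltnS leq_eqVlt; case: (prime_above _) => /= p lp _.
by case/orP => [/eqP->//|/IH h]; apply: ltn_trans lp.
Qed.

Lemma nth_prime_eq m n : (nth_prime m == nth_prime n) = (m == n).
Proof.
by case: (ltngtP m n) => [/ltn_nth_prime/ltn_eqF|/ltn_nth_prime/gtn_eqF|->];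
  rewrite ?eqxx.
Qed.

Section Lattice.
Variable D : nat -> nat -> Prop.

(** Node x is attached to the prime [nth_prime x.+1], which is invertible in the
    coefficient ring of y exactly when [D x y]. The prime [nth_prime 0] is never
    inverted, so that no coefficient ring is all of the rationals. *)
Definition coef_ring (y : nat) (b : rat) : Prop :=
  p_integral (nth_prime 0) b /\
  forall x, ~ D x y -> p_integral (nth_prime x.+1) b.

Definition lattice (v : {poly rat}) : Prop := forall y, coef_ring y v`_y.

Lemma coef_ring0 y : coef_ring y 0.
Proof. by split => *; apply: p_integral0; apply: nth_primeP. Qed.

Lemma coef_ringN y b : coef_ring y b -> coef_ring y (- b).
Proof. by case=> h h'; split => *; apply: p_integralN => //; apply: h'. Qed.

Lemma coef_ringD y b c :
  coef_ring y b -> coef_ring y c -> coef_ring y (b + c).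
Proof.
by case=> h h' [g g']; split => *; apply: p_integralD;
   [apply: nth_primeP| | |apply: nth_primeP|apply: h'|apply: g'].
Qed.

Lemma coef_ring_int y b : b \is a Num.int -> coef_ring y b.
Proof. by move=> bi; split => *; apply: p_integral_int => //; apply: nth_primeP. Qed.

Lemma coef_ring_sub x y b : (forall z, D z x -> D z y) ->
  coef_ring x b -> coef_ring y b.
Proof. by move=> h [b0 bx]; split => // z nz; apply: bx => /h. Qed.

Lemma coef_ring_divisible_eq0 y b : (forall c, coef_ring y (b * c)) -> b = 0.
Proof.
move=> h; apply: (p_integral_divisible_eq0 (nth_primeP 0)) => k.
by have [] := h ((nth_prime 0)%:R ^- k).
Qed.

Lemma lattice0 : lattice 0.
Proof. by move=> y; rewrite coef0; apply: coef_ring0. Qed.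

Lemma latticeN v : lattice v -> lattice (- v).
Proof. by move=> h y; rewrite coefN; apply: coef_ringN. Qed.

Lemma latticeD v w : lattice v -> lattice w -> lattice (v + w).
Proof. by move=> h g y; rewrite coefD; apply: coef_ringD. Qed.

Lemma latticeB v w : lattice v -> lattice w -> lattice (v - w).
Proof. by move=> h /latticeN; apply: latticeD. Qed.

(** The lattice contains no line; this is what turns congruences modulo the
    lattice into equations. *)
Lemma lattice_divisible_eq0 v : (forall c, lattice (c *: v)) -> v = 0.
Proof.
move=> h; apply/polyP => y; rewrite coef0.
by apply: (@coef_ring_divisible_eq0 y) => c; rewrite mulrC -coefZ; apply: h.
Qed.

Lemma lattice_torsion v : exists2 n, (0 < n)%N & lattice (v *+ n).
Proof.
exists (\prod_(i < size v) `|denq v`_i|)%N.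
  by apply: prodn_gt0 => i; rewrite absz_gt0 denq_neq0.
move=> y; rewrite coefMn; have [ys|ys] := ltnP y (size v); last first.
  by rewrite nth_default// mul0rn; apply: coef_ring0.
apply: coef_ring_int; rewrite (bigD1 (Ordinal ys))//= -mulr_natr natrM mulrA.
rewrite rpredM ?rpred_nat// [X in _ * X](_ : _ = (denq v`_y)%:~R) -?numqE ?rpred_int//.
by rewrite -[in RHS]absz_denq.
Qed.

Hypothesis Drefl : forall x, D x x.
Variable lev : nat -> nat.
Hypothesis Dlev : forall x y, D x y -> x <> y -> (lev x < lev y)%N.

(** The monomial 'X^x is infinitely divisible by its prime inside the lattice, and
    so is its image, whose coefficient at y must vanish if that prime is not
    invertible at y. *)
Lemma lattice_endo_support (th : {linear {poly rat} -> {poly rat}}) :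
  (forall v, lattice v -> lattice (th v)) ->
  forall x y, (th 'X^x)`_y <> 0 -> D x y.
Proof.
move=> thN x y; apply: contra_notP => nD.
apply: (p_integral_divisible_eq0 (nth_primeP x.+1)) => k.
have : lattice ((nth_prime x.+1)%:R ^- k *: 'X^x).
  move=> z; rewrite coefZ coefXn; case: eqP => [->|_]; last first.
    by rewrite mulr0; apply: coef_ring0.
  rewrite mulr1; split.
    by apply: p_integral_expV; rewrite ?nth_primeP ?nth_prime_eq.
  move=> t ntx; apply: p_integral_expV; rewrite ?nth_primeP// nth_prime_eq.
  by rewrite eqSS; apply/eqP => tx; apply: ntx; rewrite tx.
by move/thN/(_ y) => [_ /(_ _ nD)]; rewrite linearZ coefZ mulrC.
Qed.

(** An instance of dependent choice. *)
Lemma infinite_path_of (P : nat -> Prop) (E : nat -> nat -> Prop) x0 :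
  P x0 -> (forall x, P x -> exists2 y, E x y & P y) ->
  exists s : nat -> nat, forall n, E (s n) (s n.+1).
Proof.
move=> Px0 h.
have /choice[g gP] : forall u : {x | P x}, exists v : {x | P x}, E (sval u) (sval v).
  by case=> x Px; have [y Exy Py] := h x Px; exists (exist _ y Py).
by exists (fun n => sval (iter n g (exist _ x0 Px0))) => n /=.
Qed.

(** In the absence of infinite paths, induction along [D] shows that every 'X^x has
    a preimage, and one supported on levels at least that of x. The image of 'X^x
    is c 'X^x plus a combination of 'X^y with y strictly after x, and that
    combination is the image of some u supported on levels above that of x. If c is
    not zero this gives a preimage of 'X^x; if c is zero, injectivity gives
    'X^x = u, which contradicts the support of u. *)
Lemma lattice_endo_surj (th : {linear {poly rat} -> {poly rat}}) :
  (forall v, th v = 0 -> v = 0) ->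
  (forall v, lattice v -> lattice (th v)) ->
  ~ (exists s : nat -> nat, forall n, D (s n) (s n.+1) /\ s n <> s n.+1) ->
  forall w, exists v, th v = w.
Proof.
move=> thI thN wf.
have supp := lattice_endo_support thN.
pose good x := exists2 u : {poly rat}, th u = 'X^x &
  forall i, u`_i <> 0 -> (lev x <= lev i)%N.
have allgood x : good x.
  apply: contrapT => bx; apply: wf.
  pose next x y := D x y /\ x <> y.
  apply: (@infinite_path_of (fun x => ~ good x) next x bx) => {bx}x bx.
  apply: contrapT => ngb; apply: bx.
  have gs y : D x y -> x <> y -> good y.
    by move=> Dxy nxy; apply: contrapT => nby; apply: ngb; exists y.
  have /choice[u uP] y : exists u : {poly rat}, (th 'X^x)`_y <> 0 -> x <> y ->
      th u = 'X^y /\ forall i, u`_i <> 0 -> (lev y <= lev i)%N.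
    have [ny|] := pselect ((th 'X^x)`_y <> 0); last by exists 0.
    have [nxy|] := pselect (x <> y); last by exists 0.
    by have [u u1 u2] := gs y (supp _ _ ny) nxy; exists u.
  pose e := th 'X^x.
  pose u' := \sum_(i < size e | (i : nat) != x) e`_i *: u i.
  have thu' : th u' = e - e`_x *: 'X^x.
    rewrite -[X in X - _]coefK poly_def; have [xs|xs] := ltnP x (size e).
      rewrite [in RHS](bigD1 (Ordinal xs))//=.
      rewrite [RHS]addrC addKr linear_sum.
      apply: eq_bigr => i /eqP ix; rewrite linearZ/=.
      have [->|/eqP ei] := eqVneq e`_i 0; first by rewrite !scale0r.
      by have [|->] := uP i ei => //; apply: nesym.
    rewrite [X in _ - X *: _]nth_default// scale0r subr0 linear_sum.
    rewrite big_mkcond; apply: eq_bigr => i _ /=.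
    have -> : (i : nat) != x by rewrite ltn_eqF// (leq_trans (ltn_ord i)).
    have ix : x <> i by move=> xi; move: xs; rewrite xi leqNgt ltn_ord.
    rewrite linearZ/=.
    have [->|/eqP ei] := eqVneq e`_i 0; first by rewrite !scale0r.
    by have [|->] := uP i ei.
  have u'lev i : u'`_i <> 0 -> (lev x < lev i)%N.
    move=> u'i; rewrite ltnNge; apply/negP => lxi; apply: u'i.
    rewrite coef_sum big1// => j jx; rewrite coefZ.
    have [->|/eqP ej] := eqVneq e`_j 0; first by rewrite mul0r.
    have jx' : x <> j by apply/nesym/eqP.
    have [_ lu] := uP j ej jx'.
    have [->|/eqP/lu lji] := eqVneq (u j)`_i 0; first by rewrite mulr0.
    have := leq_ltn_trans lxi (Dlev (supp _ _ ej) jx').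
    by rewrite ltnNge lji.
  have [c0|c0] := eqVneq e`_x 0.
    suff xu' : 'X^x = u'.
      have : u'`_x <> 0 by rewrite -xu' coefXn eqxx; apply/eqP; rewrite oner_neq0.
      by move/u'lev; rewrite ltnn.
    apply/eqP; rewrite -subr_eq0; apply/eqP/thI.
    by rewrite linearB/= thu' c0 scale0r subr0 subrr.
  exists ((e`_x)^-1 *: ('X^x - u')).
    rewrite linearZ/= linearB/= thu' opprB addrCA subrr addr0 scalerA mulVf// scale1r//.
  move=> i; rewrite coefZ coefB coefXn; have [->//|ix] := eqVneq i x.
  rewrite sub0r => ni; apply/ltnW/u'lev => u'0.
  by apply: ni; rewrite u'0 oppr0 mulr0.
have /choice[u uP] x : exists u, th u = 'X^x.
  by have [u] := allgood x; exists u.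
move=> w; exists (\sum_(i < size w) w`_i *: u i).
rewrite linear_sum -[RHS]coefK poly_def; apply: eq_bigr => i _.
by rewrite linearZ/= uP.
Qed.

End Lattice.

(** * Quotients of the rational Heisenberg group *)

(** The Heisenberg group over the rationals attached to the vector space of
    polynomials: (a, v, z) stands for the matrix with a, v above the diagonal and z
    in the corner. *)
Definition heis : countType := (rat * {poly rat} * {poly rat})%type.

Definition hmul (g h : heis) : heis :=
  (g.1.1 + h.1.1, g.1.2 + h.1.2, g.2 + h.2 + g.1.1 *: h.1.2).

Definition hinv (g : heis) : heis :=
  (- g.1.1, - g.1.2, - g.2 + g.1.1 *: g.1.2).

Definition hone : heis := (0, 0, 0).

(** Congruence modulo the lattice, seen inside the centre. The quotient groups are
    handled through this relation. *)
Definition heis_eq (D : nat -> nat -> Prop) (g h : heis) : Prop :=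
  g.1 = h.1 /\ lattice D (g.2 - h.2).

Definition endo_fst (F : heis -> heis) (g : heis) : rat^o * {poly rat} := (F g).1.

Section HeisenbergQuotient.
Variable D : nat -> nat -> Prop.
Local Notation "g ~~ h" := (heis_eq D g h) (at level 70).

Lemma heis_eq_refl g : g ~~ g.
Proof. by split; rewrite ?subrr//; apply: lattice0. Qed.

Lemma heis_eq_sym g h : g ~~ h -> h ~~ g.
Proof. by case=> e l; split; rewrite // -opprB; apply: latticeN. Qed.

Lemma heis_eq_trans g h k : g ~~ h -> h ~~ k -> g ~~ k.
Proof.
by case=> e l [e' l']; split; rewrite ?e// -(subrKA h.2); apply: latticeD.
Qed.

Lemma heis_eq_mul g g' h h' : g ~~ g' -> h ~~ h' -> hmul g h ~~ hmul g' h'.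
Proof.
case: g g' h h' => [[a v] z] [[a' v'] z'] [[b w] y] [[b' w'] y'].
move=> [[/= -> ->] lz] [[/= -> ->] ly]; split => //=.
by rewrite opprD addrACA subrr addr0 opprD addrACA; apply: latticeD.
Qed.

Lemma heis_eq_inv g g' : g ~~ g' -> hinv g ~~ hinv g'.
Proof.
case: g g' => [[a v] z] [[a' v'] z'] [[/= -> ->] lz]; split => //=.
by rewrite opprD addrACA subrr addr0 opprK addrC -opprB; apply: latticeN.
Qed.

Lemma hmulA : associative hmul.
Proof.
move=> [[a v] z] [[a' v'] z'] [[b w] y]; rewrite /hmul/=; congr (_, _, _).
- by rewrite addrA.
- by rewrite addrA.
- by rewrite -!mul_polyC polyCD; ring.
Qed.

Lemma hmul1g : left_id hone hmul.
Proof. by move=> [[a v] z]; rewrite /hmul/= !add0r scale0r addr0. Qed.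

Lemma hmulg1 : right_id hone hmul.
Proof. by move=> [[a v] z]; rewrite /hmul/= !addr0 scaler0 addr0. Qed.

Lemma hmulVg : left_inverse hone hinv hmul.
Proof.
move=> [[a v] z]; rewrite /hmul/hinv/hone/= !addNr; congr (_, _, _).
by rewrite -!mul_polyC polyCN; ring.
Qed.

Lemma hmulgV : right_inverse hone hinv hmul.
Proof.
move=> [[a v] z]; rewrite /hmul/hinv/hone/= !addrN; congr (_, _, _).
by rewrite -!mul_polyC; ring.
Qed.

Definition hcomm (g h : heis) : heis :=
  hmul (hmul (hinv g) (hinv h)) (hmul g h).

Lemma hcommE g h : hcomm g h = (0, 0, g.1.1 *: h.1.2 - h.1.1 *: g.1.2).
Proof.
case: g h => [[a v] z] [[b w] y]; rewrite /hcomm /hmul/=; congr (_, _, _).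
- by ring.
- by ring.
- by rewrite -!mul_polyC !(polyCD, polyCN); ring.
Qed.

(** An injective endomorphism of the quotient, lifted to the Heisenberg group. *)
Section Endo.
Variable F : heis -> heis.
Hypothesis Fmul : forall g h, F (hmul g h) ~~ hmul (F g) (F h).
Hypothesis Finj : forall g h, F g ~~ F h <-> g ~~ h.

Local Notation vec := (rat^o * {poly rat})%type.
Local Notation f := (endo_fst F).

Lemma endo_fstM g h : f (hmul g h) = f g + f h.
Proof. by have [] := Fmul g h; rewrite /endo_fst => ->. Qed.

Lemma endo_fst1 : f hone = 0.
Proof.
have /eqP := endo_fstM hone hone.
by rewrite hmul1g addrC -subr_eq subrr eq_sym => /eqP.
Qed.

(** The centre is torsion modulo the lattice, while the first two coordinates live
    in a torsion-free group. *)
Lemma endo_fst_central z : f (0, z) = 0.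
Proof.
have [n n0 lz] := lattice_torsion D z.
have fM m : f (0, z *+ m) = f (0, z) *+ m.
  elim: m => [|m IH]; first by rewrite !mulr0n; apply: endo_fst1.
  by rewrite [in RHS]mulrS -IH -endo_fstM /hmul/= !addr0 scaler0 addr0 mulrS.
have [|e _] := (Finj (0, z *+ n) hone).2; first by split; rewrite //= subr0.
have /eqP : f (0, z *+ n) = 0 by rewrite /endo_fst e; apply: endo_fst1.
by rewrite fM -scaler_nat scaler_eq0 pnatr_eq0 eqn0Ngt n0 => /eqP.
Qed.

Lemma endo_fstE p z : f (p, z) = f (p, 0).
Proof.
have -> : (p, z) = hmul (p, 0) (0, z).
  by case: p => a v; rewrite /hmul/= !addr0 scaler0 add0r addr0.
by rewrite endo_fstM endo_fst_central addr0.
Qed.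

Lemma endo_quotient_additive : zmod_morphism (fun p : vec => f (p, 0)).
Proof.
move=> [a v] [b w]; apply/eqP; rewrite eq_sym subr_eq -endo_fstM /hmul/= !subrK.
by rewrite [X in _ == X]endo_fstE.
Qed.

Lemma endo_commute g h : hmul (F g) (F h) ~~ hmul (F h) (F g) <->
  hmul g h ~~ hmul h g.
Proof.
split=> e.
  apply/Finj; apply: heis_eq_trans (heis_eq_sym (Fmul h g)).
  exact: heis_eq_trans (Fmul g h) e.
apply: heis_eq_trans (Fmul h g).
by apply: heis_eq_trans (heis_eq_sym (Fmul g h)) _; apply/Finj.
Qed.

Lemma commuteE g h : hmul g h ~~ hmul h g <->
  lattice D (g.1.1 *: h.1.2 - h.1.1 *: g.1.2).
Proof.
rewrite /heis_eq /= [g.2 + _]addrC opprD addrACA subrr add0r.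
by split=> [[]//|l]; split=> //; congr (_, _); rewrite addrC.
Qed.

Lemma lattice_scale1_eq0 (a : rat) : (forall c, lattice D (c *: (a *: 1))) -> a = 0.
Proof.
by move=> /lattice_divisible_eq0/eqP; rewrite scaler_eq0 oner_eq0 orbF => /eqP.
Qed.

(** Additive maps between rational vector spaces are linear. *)
Lemma endo_quotient_linear :
  exists quot : {linear vec -> vec}, forall p, (F (p, 0)).1 = quot p.
Proof.
pose quot : {linear vec -> vec} := HB.pack (fun p : vec => f (p, 0))
  (GRing.isZmodMorphism.Build _ _ _ endo_quotient_additive)
  (GRing.isScalable.Build _ _ _ _ _ (rat_linear endo_quotient_additive)).
by exists quot.
Qed.

(** [quot] is the linear map induced on the quotient by the centre. *)
Section Quotient.
Variable quot : {linear vec -> vec}.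
Hypothesis quotE : forall p, (F (p, 0)).1 = quot p.

(** The centre is detected by commutators, and an injective endomorphism reflects
    commutation. *)
Lemma endo_quotient_inj p : quot p = 0 -> p = 0.
Proof.
case: p => a v e; have comm (h : heis) : lattice D (a *: h.1.2 - h.1.1 *: v).
  apply: (commuteE ((a, v), 0) h).1; apply: (endo_commute _ _).1.
  apply: (commuteE _ _).2; rewrite quotE e scale0r scaler0 subr0.
  exact: lattice0.
have v0 : v = 0.
  apply: (@lattice_divisible_eq0 D) => c; have := comm ((- c, 0), 0).
  by rewrite /= scaler0 sub0r scaleNr opprK.
have a0 : a = 0; last by rewrite a0 v0.
apply: lattice_scale1_eq0 => c; have := comm ((0, c *: 1), 0).
by rewrite /= scale0r subr0 !scalerA mulrC.
Qed.

Definition axis_coord (v : {poly rat}) : rat^o := (quot (0, v)).1.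
Definition plane_coord (v : {poly rat}) : {poly rat} := (quot (0, v)).2.

Lemma quot_plane_sub v w : quot (0, v - w) = quot (0, v) - quot (0, w).
Proof. by rewrite -linearB /=; congr (quot (_, _)); rewrite /= subr0. Qed.

Lemma axis_coord_additive : zmod_morphism axis_coord.
Proof. by move=> v w; rewrite /axis_coord quot_plane_sub. Qed.

Lemma plane_coord_additive : zmod_morphism plane_coord.
Proof. by move=> v w; rewrite /plane_coord quot_plane_sub. Qed.

Lemma axis_coord_scalable : scalable axis_coord.
Proof. exact: rat_linear axis_coord_additive. Qed.

Lemma plane_coord_scalable : scalable plane_coord.
Proof. exact: rat_linear plane_coord_additive. Qed.

Lemma plane_coords_eq0 v : axis_coord v = 0 -> plane_coord v = 0 -> v = 0.
Proof.
move=> a0 p0; suff [] : ((0, v) : vec) = 0 by [].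
apply: endo_quotient_inj; rewrite [quot _]surjective_pairing.
by rewrite -/(axis_coord v) -/(plane_coord v) a0 p0.
Qed.

(** The plane of the elements (0, v) is commutative, so the images of any two of its
    vectors satisfy a w' = a' w. If some a is not zero, all the images lie on one
    line, which injectivity forbids in dimension two: 1 and 'X are compared. *)
Lemma axis_coord_eq0 v : (quot (0, v)).1 = 0.
Proof.
have prop w x : axis_coord w *: plane_coord x = axis_coord x *: plane_coord w.
  apply/eqP; rewrite -subr_eq0; apply/eqP/(@lattice_divisible_eq0 D) => c.
  have : hmul (0, c *: w, 0) (0, x, 0) ~~ hmul (0, x, 0) (0, c *: w, 0).
    by apply: (commuteE _ _).2; rewrite /= !scale0r subrr; apply: lattice0.
  move=> /(endo_commute _ _).2/(commuteE _ _).1; rewrite !quotE.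
  rewrite -/(axis_coord _) -/(plane_coord _) -/(axis_coord _) -/(plane_coord _).
  rewrite axis_coord_scalable plane_coord_scalable.
  by rewrite scalerBr !scalerA [c * axis_coord x]mulrC.
apply/eqP/negPn/negP; rewrite -/(axis_coord v) => a0.
have span w : axis_coord v *: w = axis_coord w *: v.
  apply/eqP; rewrite -subr_eq0; apply/eqP/plane_coords_eq0.
    by rewrite axis_coord_additive !axis_coord_scalable -![_ *: _]/(_ * _) mulrC subrr.
  by rewrite plane_coord_additive !plane_coord_scalable prop subrr.
have /(congr1 (fun p : {poly rat} => p`_0)) := span 'X.
have /(congr1 (fun p : {poly rat} => p`_0)) := span 1.
rewrite !coefZ !coef1 !coefX/= !mulr0 !mulr1 => e /esym/eqP.
rewrite mulf_eq0 => /orP[/eqP aX|/eqP v0].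
  have /(congr1 (fun p : {poly rat} => p`_1)) := span 'X.
  rewrite !coefZ !coefX/= aX mul0r mulr1; apply/eqP.
  exact: a0.
by move: a0; rewrite e v0 mulr0 eqxx.
Qed.

Definition axis_scale : rat := (quot (1, 0)).1.

Lemma plane_coord_inj v : plane_coord v = 0 -> v = 0.
Proof. by apply: plane_coords_eq0; apply: axis_coord_eq0. Qed.

Lemma endo_fst_plane v : (F (0, v, 0)).1 = (0, plane_coord v).
Proof.
by rewrite quotE [LHS]surjective_pairing axis_coord_eq0.
Qed.

(** Otherwise (1, 0, 0) would be sent into the commutative plane. *)
Lemma axis_scale_neq0 : axis_scale != 0.
Proof.
apply/eqP => r0; suff : (1 : rat) = 0 by apply/eqP; rewrite oner_eq0.
apply: lattice_scale1_eq0 => c; rewrite scale1r.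
have : hmul (1, 0, 0) (0, c *: 1, 0) ~~ hmul (0, c *: 1, 0) (1, 0, 0).
  apply: (endo_commute _ _).1; apply: (commuteE _ _).2.
  rewrite endo_fst_plane !quotE -/axis_scale r0 /= !scale0r subrr.
  exact: lattice0.
by move/(commuteE _ _).1; rewrite /= scale0r subr0 scale1r.
Qed.

Lemma scaled_plane_coord_additive :
  zmod_morphism (fun v => axis_scale *: plane_coord v).
Proof. by move=> v w; rewrite plane_coord_additive scalerBr. Qed.

(** The commutator of (1, 0, 0) and (0, z, 0) is the central element z, so the action
    on the centre is the action on the plane multiplied by [axis_scale]. *)
Lemma endo_linear_part : exists2 th : {linear {poly rat} -> {poly rat}},
  (forall v, th v = axis_scale *: plane_coord v) & forall z, F (0, z) ~~ (0, th z).
Proof.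
pose th : {linear {poly rat} -> {poly rat}} := HB.pack
  (fun v => axis_scale *: plane_coord v)
  (GRing.isZmodMorphism.Build _ _ _ scaled_plane_coord_additive)
  (GRing.isScalable.Build _ _ _ _ _ (rat_linear scaled_plane_coord_additive)).
exists th => // z; split; first exact: endo_fst_central.
have e : hmul (1, 0, 0) (0, z, 0) = hmul (0, z) (hmul (0, z, 0) (1, 0, 0)).
  by rewrite /hmul/= !(add0r, addr0, scale1r, scale0r, scaler0).
have := Fmul (1, 0, 0) (0, z, 0); rewrite e.
have := heis_eq_trans (Fmul (0, z) _)
  (heis_eq_mul (heis_eq_refl _) (Fmul (0, z, 0) (1, 0, 0))).
move=> /heis_eq_sym/heis_eq_trans/[apply]/=[[_ /=]].
rewrite [(F (1, 0, 0)).1]quotE endo_fst_plane /= -[(F (0, z)).1]/(f (0, z)).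
rewrite endo_fst_central /= !scale0r !addr0 -/axis_scale.
congr lattice; rewrite opprD addrA; congr (_ - _).
by rewrite [X in _ + X - _]addrC addrK.
Qed.

Hypothesis Drefl : forall x, D x x.
Variable lev : nat -> nat.
Hypothesis Dlev : forall x y, D x y -> x <> y -> (lev x < lev y)%N.
Hypothesis wf :
  ~ exists s : nat -> nat, forall n, D (s n) (s n.+1) /\ s n <> s n.+1.

(** The linear map on the centre preserves the lattice, so it is onto; hence so are
    the maps on the plane and on the quotient by the centre. *)
Lemma endo_surj_of_quotient k : exists h, F h ~~ k.
Proof.
have [th thE Fth] := endo_linear_part.
have th_onto : forall w, exists v, th v = w.
  apply: (lattice_endo_surj Drefl Dlev) wf => [v|z lz].
    rewrite thE => /eqP; rewrite scaler_eq0 (negPf axis_scale_neq0).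
    by move=> /eqP/plane_coord_inj.
  have [|_ l] := (Finj (0, z) hone).2; first by split; rewrite //= subr0.
  have l1 : lattice D ((F (0, z)).2 - (F hone).2) by [].
  have [_ l2] := Fth z; have [_ l3] := Fth 0.
  move: l2 l3; rewrite /= linear0 subr0 => l2 l3.
  have -> : th z = ((F (0, z)).2 - (F hone).2) + (F hone).2 - ((F (0, z)).2 - th z).
    by rewrite subrK opprB addrC subrK.
  by apply: latticeB => //; apply: latticeD.
case: k => [[a v] z].
pose a0 := a / axis_scale.
have [v1 v1E] := th_onto (axis_scale *: (v - (quot (a0 : rat^o, 0)).2)).
have F1 : (F (a0, v1, 0)).1 = (a, v).
  have -> : (F (a0, v1, 0)).1 = quot (a0, 0) + quot (0, v1).
    by rewrite quotE -linearD /=; congr (quot (_, _)); rewrite /= ?addr0 ?add0r.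
  have -> : quot (0, v1) = (0, plane_coord v1).
    by rewrite [LHS]surjective_pairing axis_coord_eq0.
  have -> : plane_coord v1 = v - (quot (a0 : rat^o, 0)).2.
    by apply: (scalerI axis_scale_neq0); rewrite -v1E thE.
  have a0E : (quot (a0 : rat^o, 0)).1 = a.
    have -> : quot (a0, 0) = a0 *: quot (1, 0).
      rewrite -linearZ /=; congr (quot (_, _)); rewrite /= ?scaler0//.
      by rewrite -[_ *: _]/(_ * _) mulr1.
    by rewrite -[LHS]/(a0 * axis_scale) mulfVK// axis_scale_neq0.
  rewrite [X in X + _]surjective_pairing a0E /=.
  by congr (_, _); rewrite /= ?addr0// addrC subrK.
have [z0 z0E] := th_onto (z - (F (a0, v1, 0)).2).
exists (hmul (0, z0) (a0, v1, 0)).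
apply: heis_eq_trans (Fmul _ _) _.
apply: heis_eq_trans (heis_eq_mul (Fth z0) (heis_eq_refl _)) _.
rewrite [F (a0, _, _)]surjective_pairing F1 z0E /hmul /= scale0r !add0r addr0 subrK.
exact: heis_eq_refl.
Qed.
End Quotient.

Lemma endo_surj lev : (forall x, D x x) ->
  (forall x y, D x y -> x <> y -> (lev x < lev y)%N) ->
  (~ exists s : nat -> nat, forall n, D (s n) (s n.+1) /\ s n <> s n.+1) ->
  forall k, exists h, F h ~~ k.
Proof.
move=> Dr Dl wf; have [q qE] := endo_quotient_linear.
exact: endo_surj_of_quotient qE Dr _ Dl wf.
Qed.

End Endo.
End HeisenbergQuotient.

(** * Shifting along an infinite path *)

Section PathShift.
Variables (D : nat -> nat -> Prop) (s : nat -> nat).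
Hypothesis Dtrans : forall x y z, D x y -> D y z -> D x z.
Hypothesis Ds : forall n, D (s n) (s n.+1).
Hypothesis s_inj : injective s.

(** The linear map sending 'X^(s n) to 'X^(s n.+1) and every other monomial to 0,
    described by its effect on coefficients. *)
Lemma path_shift : exists sh : {linear {poly rat} -> {poly rat}},
  (forall v n, (sh v)`_(s n.+1) = v`_(s n)) /\
  (forall v y, (forall n, s n.+1 <> y) -> (sh v)`_y = 0).
Proof.
have /choice[c cP] i : exists c : {poly rat},
    (forall n, s n = i -> c = 'X^(s n.+1)) /\ ((forall n, s n <> i) -> c = 0).
  have [[n <-]|h] := pselect (exists n, s n = i).
    by exists 'X^(s n.+1); split=> [m /s_inj->//|/(_ n)].
  by exists 0; split=> // n ni; case: h; exists n.
pose L (v : {poly rat}) := \sum_(i < size v) v`_i *: c i.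
have LS v n : (L v)`_(s n.+1) = v`_(s n).
  have cE (i : 'I_(size v)) : (c i)`_(s n.+1) = ((i : nat) == s n)%:R.
    have [[m mi]|h] := pselect (exists m, s m = i).
      rewrite ((cP i).1 _ mi) coefXn -mi !(inj_eq s_inj) eqSS.
      by rewrite eq_sym.
    rewrite (cP i).2 ?coef0; last by move=> m mi; apply: h; exists m.
    by case: eqP => // ni; case: h; exists n.
  rewrite coef_sum; have [lt|ge] := ltnP (s n) (size v).
    rewrite (bigD1 (Ordinal lt))//= big1 => [|i ni].
      by rewrite addr0 coefZ (cE (Ordinal lt)) eqxx mulr1.
    rewrite coefZ cE -[s n]/(nat_of_ord (Ordinal lt)) (inj_eq val_inj).
    by rewrite (negPf ni) mulr0.
  rewrite big1 ?nth_default// => i _; rewrite coefZ cE ltn_eqF ?mulr0//.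
  exact: leq_trans ge.
have L0 v y : (forall n, s n.+1 <> y) -> (L v)`_y = 0.
  move=> h; rewrite coef_sum big1// => i _; rewrite coefZ.
  have [[m mi]|g] := pselect (exists m, s m = i).
    rewrite ((cP i).1 _ mi) coefXn; case: eqP => [/esym/h//|_].
    by rewrite mulr0.
  by rewrite (cP i).2 ?coef0 ?mulr0// => m mi; apply: g; exists m.
have Llin : zmod_morphism L.
  move=> v w; apply/polyP => y; rewrite coefB.
  have [[n <-]|h] := pselect (exists n, s n.+1 = y); first by rewrite !LS coefB.
  by rewrite !L0 ?subrr// => n e; apply: h; exists n.
pose sh : {linear {poly rat} -> {poly rat}} := HB.pack L
  (GRing.isZmodMorphism.Build _ _ _ Llin)
  (GRing.isScalable.Build _ _ _ _ _ (rat_linear Llin)).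
by exists sh.
Qed.

(** With sh the shift along the path, v |-> v + sh v is injective and respects the
    lattice in both directions: coefficients can be recovered one after the other
    along the path, and the coefficient rings increase along it. It is not onto: a
    preimage of 'X^(s 0) would have coefficients 1, -1, 1, ... along the path. *)
Lemma path_endo : exists F : heis -> heis,
  [/\ forall g h, heis_eq D (F (hmul g h)) (hmul (F g) (F h)),
      forall g h, heis_eq D (F g) (F h) <-> heis_eq D g h
    & exists k, forall h, ~ heis_eq D (F h) k].
Proof.
have [sh [shS sh0]] := path_shift.
(* Recovering a property of the coefficients of v from those of v + sh v. *)
have ind (P : nat -> rat -> Prop) (v : {poly rat}) :
    (forall y, (forall n, s n.+1 <> y) -> P y (v + sh v)`_y -> P y v`_y) ->
    (forall n, P (s n) v`_(s n) -> P (s n.+1) (v + sh v)`_(s n.+1) ->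
       P (s n.+1) v`_(s n.+1)) ->
    (forall y, P y (v + sh v)`_y) -> forall y, P y v`_y.
  move=> h0 hS Pv; have Ps n : P (s n) v`_(s n).
    elim: n => [|n IH]; last exact: hS.
    by apply: h0 => // n /s_inj.
  move=> y; have [[n <-]|h] := pselect (exists n, s n.+1 = y); first exact: Ps.
  by apply: h0 => // n e; apply: h; exists n.
have thN v : lattice D (v + sh v) <-> lattice D v.
  have sub n b : coef_ring D (s n) b -> coef_ring D (s n.+1) b.
    by apply: coef_ring_sub => x /Dtrans; apply.
  split=> [lv|lv y].
    apply: (ind (coef_ring D)) => // [y h|n].
      by rewrite coefD sh0// addr0.
    rewrite coefD shS => /sub h1 h2.
    rewrite -[v`_(s n.+1)](addrK v`_(s n)).
    by apply: coef_ringD => //; apply: coef_ringN.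
  rewrite coefD; apply: coef_ringD; first exact: lv.
  have [[n <-]|h] := pselect (exists n, s n.+1 = y).
    by rewrite shS; apply: sub; apply: lv.
  by rewrite sh0 ?coef_ring0// => [|n e]; [apply: coef_ring0|apply: h; exists n].
have th_inj v : v + sh v = 0 -> v = 0.
  move=> v0; apply/polyP.
  apply: (ind (fun y b => b = (0 : {poly rat})`_y)) => [y h|n|y].
  - by rewrite coefD sh0// addr0.
  - by rewrite !coef0 coefD shS => ->; rewrite addr0.
  - by rewrite v0.
exists (fun g => (g.1.1, g.1.2 + sh g.1.2, g.2 + sh g.2)); split.
- move=> [[a v] z] [[b w] y]; rewrite /hmul/=.
  set g := (X in heis_eq D X _); set h := (X in heis_eq D _ X).
  suff -> : g = h by apply: heis_eq_refl.
  rewrite /g /h !linearD/= linearZ/=; congr (_, _, _).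
    by rewrite [LHS]addrACA.
  by rewrite -!mul_polyC; ring.
- move=> [[a v] z] [[b w] y]; rewrite /heis_eq/=.
  have -> : z + sh z - (y + sh y) = (z - y) + sh (z - y).
    by rewrite linearB opprD addrACA.
  split=> -[[-> e] /thN l]; split => //; last by rewrite e.
  congr (_, _); apply/eqP; rewrite -subr_eq0; apply/eqP/th_inj.
  by rewrite linearB addrACA -opprD e subrr.
- exists (0, 'X^(s 0%N), 0) => -[[a v] z] [/= [_ e] _].
  have nz n : v`_(s n) != 0.
    elim: n => [|n IH].
      have := congr1 (fun p : {poly rat} => p`_(s 0%N)) e.
      rewrite coefD sh0 ?addr0 => [->|n /s_inj//].
      by rewrite coefXn eqxx oner_eq0.
    have := congr1 (fun p : {poly rat} => p`_(s n.+1)) e.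
    rewrite coefD shS coefXn (inj_eq s_inj) /= => /eqP.
    by rewrite addr_eq0 => /eqP ->; rewrite oppr_eq0.
  have : (size (map s (iota 0 (size v).+1)) <= size (iota 0 (size v)))%N.
    apply: uniq_leq_size; first by rewrite (map_inj_uniq s_inj) iota_uniq.
    move=> y /mapP[n _ ->]; rewrite mem_iota add0n /= ltnNge.
    by apply/negP => /(nth_default 0)/eqP; apply/negP.
  by rewrite size_map !size_iota ltnn.
Qed.
End PathShift.

Local Close Scope ring_scope.

(** * Nilpotency of class two *)

Section NilpotentClassTwo.
Variable G : group_structure.
Hypothesis Ggroup : is_group G.
Local Notation "x ** y" := (gmul G x y) (at level 40, left associativity).
Local Notation one := (gone G).
Local Notation inv := (ginv G).
Local Notation comm := (commutator G).

Lemma comm_eq1 x y : comm x y = one <-> x ** y = y ** x.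
Proof.
have [A L R V W] := Ggroup; have e : comm x y = inv (y ** x) ** (x ** y).
  congr (_ ** _); rewrite -[LHS]R -(W (y ** x)) A [X in X ** _](_ : _ = one) ?L//.
  by rewrite A -(A (inv x)) V R V.
rewrite e; split=> [h|->]; last exact: V.
by rewrite -[RHS]R -h A W L.
Qed.

(** The second term of the lower central series is trivial when commutators are
    central, because the centre is a subgroup. *)
Lemma nilpotent_class2P : nilpotent_of_class G 2 <->
  (forall x y z, comm (comm x y) z = one) /\ exists x y, comm x y <> one.
Proof.
have [A L R V W] := Ggroup.
have comm1 z : comm one z = one by apply/comm_eq1; rewrite L R.
split=> [[h2 h1]|[h2 [x0 [y0 c0]]]].
  split=> [x y z|].
    suff : lower_central G 2 (comm (comm x y) z) by rewrite h2.
    move=> H [_ HH]; apply: HH; exists (comm x y) => [K [_ KK]|].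
      by apply: KK; exists x => //; exists y.
    by exists z.
  apply: contrapT => h; apply: (h1 1%N) => //.
  apply/seteqP; split=> [x /(_ [set one])|x ->].
    apply; split; first by split=> [//|_ _ -> -> //|_ ->]; rewrite ?L// -[inv one]L W.
    move=> _ [x' _ [y _ <-]]; apply: contrapT => n; apply: h; by exists x', y.
  by move=> H [[]].
have center : is_subgroup G [set x | forall z, comm x z = one].
  split=> [//|x y cx cy z|x cx z]; apply/comm_eq1.
    have /comm_eq1 xz := cx z; have /comm_eq1 yz := cy z.
    by rewrite -A yz A xz A.
  have /comm_eq1 xz := cx z.
  by rewrite -[in LHS](R z) -(W x) (A z) -xz -(A x) (A (inv x)) V L.
split.
  apply/seteqP; split=> [x /(_ [set one])|x ->]; last by move=> H [[]].
  apply; split; first by split=> [//|_ _ -> -> //|_ ->]; rewrite ?L// -[inv one]L W.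
  move=> _ [x' x'c [y _ <-]]; suff : [set x | forall z, comm x z = one] x' by apply.
  by apply: x'c; split=> // _ [u _ [v _ <-]] z; apply: h2.
case=> [|[|//]] _ /= e.
  have one_all n : n = one by have : [set: nat] n by []; rewrite e.
  by have := one_all 0%N; rewrite -(one_all 1%N).
suff : [set one] (comm x0 y0) by [].
by rewrite -e => H [_ HH]; apply: HH; exists x0 => //; exists y0.
Qed.
End NilpotentClassTwo.

(** * A Borel family of groups on the natural numbers *)

Definition enumerated_group (en : nat -> heis) (idx : heis -> nat) :
    group_structure :=
  ((fun p => idx (hmul (en p.1) (en p.2)), fun n => idx (hinv (en n))),
   idx hone).

(** [en] lists one representative of each class modulo the lattice, and [idx] gives
    the position of a class in this list. *)
Section EnumeratedQuotient.
Variables (D : nat -> nat -> Prop) (en : nat -> heis) (idx : heis -> nat).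
Hypothesis idxE : forall g h, idx g = idx h <-> heis_eq D g h.
Hypothesis enK : forall n, idx (en n) = n.
Local Notation G := (enumerated_group en idx).

Lemma en_idx g : heis_eq D (en (idx g)) g.
Proof. by apply/idxE; rewrite enK. Qed.

Lemma idx_mul g h : gmul G (idx g) (idx h) = idx (hmul g h).
Proof. by apply/idxE; apply: heis_eq_mul; apply: en_idx. Qed.

Lemma idx_inv g : ginv G (idx g) = idx (hinv g).
Proof. by apply/idxE; apply: heis_eq_inv; apply: en_idx. Qed.

Lemma idx_comm g h : commutator G (idx g) (idx h) = idx (hcomm g h).
Proof. by rewrite /commutator !idx_inv !idx_mul. Qed.

Lemma enumerated_is_group : is_group G.
Proof.
have one : gone G = idx hone by [].
split=> [x y z|x|x|x|x]; rewrite ?one -[x]enK.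
- by rewrite -[y]enK -[z]enK !idx_mul hmulA.
- by rewrite idx_mul hmul1g.
- by rewrite idx_mul hmulg1.
- by rewrite idx_inv idx_mul hmulVg.
- by rewrite idx_inv idx_mul hmulgV.
Qed.

Lemma enumerated_nilpotent2 : nilpotent_of_class G 2.
Proof.
apply: (nilpotent_class2P enumerated_is_group).2; split=> [x y z|].
  rewrite -[x]enK -[y]enK -[z]enK !idx_comm !hcommE /=; congr idx.
  by rewrite scale0r scaler0 subrr.
apply: contrapT => h.
suff : (1 : rat)%R = 0%R by apply/eqP; rewrite oner_eq0.
apply: (@lattice_scale1_eq0 D) => c; rewrite scale1r.
have /idxE[_] : idx (hcomm (c, 0, 0)%R (0, 1, 0)%R) = idx hone.
  apply: contrapT => nc; apply: h.
  by exists (idx (c, 0, 0)%R), (idx (0, 1, 0)%R); rewrite idx_comm.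
by rewrite hcommE /= scale0r !subr0.
Qed.

(** Endomorphisms lift along [en] and descend along [idx]. *)
Lemma enumerated_co_hopfianP : co_hopfian G <->
  forall F : heis -> heis,
    (forall g h, heis_eq D (F (hmul g h)) (hmul (F g) (F h))) ->
    (forall g h, heis_eq D (F g) (F h) <-> heis_eq D g h) ->
    forall k, exists h, heis_eq D (F h) k.
Proof.
split=> [ch F Fmul Finj k|h f fM fI n].
  have FE g : idx (F (en (idx g))) = idx (F g) by apply/idxE/Finj; apply: en_idx.
  have fM : {morph (fun n => idx (F (en n))) : x y / gmul G x y}.
    move=> x y /=; rewrite -[x]enK -[y]enK idx_mul FE idx_mul !enK.
    by apply/idxE; apply: Fmul.
  have fI : injective (fun n => idx (F (en n))).
    by move=> x y /idxE/Finj/idxE; rewrite !enK.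
  by have [m mk] := ch _ fM fI (idx k); exists (en m); apply/idxE.
have gM g g' : heis_eq D (en (f (idx (hmul g g'))))
    (hmul (en (f (idx g))) (en (f (idx g')))).
  by apply/idxE; rewrite enK -idx_mul fM -idx_mul !enK.
have gI g g' : heis_eq D (en (f (idx g))) (en (f (idx g'))) <-> heis_eq D g g'.
  split=> [/idxE|/idxE ->]; last exact: heis_eq_refl.
  by rewrite !enK => /fI /idxE.
have [g gn] := h (fun g => en (f (idx g))) gM gI (en n).
by exists (idx g); move/idxE: gn; rewrite !enK.
Qed.

Lemma enumerated_co_hopfian_path (lev : nat -> nat) :
  (forall x, D x x) -> (forall x y z, D x y -> D y z -> D x z) ->
  (forall x y, D x y -> x <> y -> (lev x < lev y)%N) ->
  co_hopfian G <->
  ~ exists s : nat -> nat, forall n, D (s n) (s n.+1) /\ s n <> s n.+1.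
Proof.
move=> Dr Dt Dl; split=> [/enumerated_co_hopfianP ch [s Ds]|wf]; last first.
  apply/enumerated_co_hopfianP => F Fm Fi k.
  by apply: (endo_surj Fm Fi Dr Dl wf).
have lt m n : (m < n)%N -> (lev (s m) < lev (s n))%N.
  elim: n => // n IH; have [dn nn] := Ds n; have l := Dl _ _ dn nn.
  by rewrite ltnS leq_eqVlt => /orP[/eqP->//|/IH/ltn_trans]; apply.
have s_inj : injective s.
  move=> m n e; case: (ltngtP m n) => // /lt; by rewrite e ltnn.
have [F [Fm Fi [k nk]]] := path_endo Dt (fun n => (Ds n).1) s_inj.
by have [h /nk] := ch F Fm Fi k.
Qed.
End EnumeratedQuotient.

Section BorelFamily.
Variables (Y : Type) (S : set (set Y)) (D : Y -> nat -> nat -> Prop).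
Hypothesis S_sigma : sigma_algebra setT S.
Hypothesis D_meas : forall a b, S (fun y => D y a b).

Lemma heis_eq_meas g h : S (fun y => heis_eq (D y) g h).
Proof.
apply: meas_and => //; first exact: meas_const.
apply: (@meas_all _ _ S_sigma nat) => n; apply: meas_and => //; first exact: meas_const.
apply: (@meas_all _ _ S_sigma nat) => x; apply: meas_imply => //; last exact: meas_const.
exact: measN.
Qed.

Lemma borel_group_family : exists G : Y -> group_structure,
  [/\ forall y, exists en idx, G y = enumerated_group en idx /\
        (forall g h, idx g = idx h <-> heis_eq (D y) g h) /\ (forall n, idx (en n) = n),
      forall a b, fiber_measurable S (fun y => gmul (G y) a b),
      forall a, fiber_measurable S (fun y => ginv (G y) a)
    & fiber_measurable S (fun y => gone (G y))].
Proof.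
have [|||||en [idx [idxE enK idxm enm]]] :=
  @quotient_enumeration Y S S_sigma heis (fun y => heis_eq (D y))
    (fun n => (n%:R, 0, 0)%R).
- by move=> y h; apply: heis_eq_refl.
- by move=> y g h; apply: heis_eq_sym.
- by move=> y g h k; apply: heis_eq_trans.
- exact: heis_eq_meas.
- move=> y i j [[/eqP]]; rewrite eqr_nat => /eqP //.
exists (fun y => enumerated_group (en y) (idx y)); split.
- by move=> y; exists (en y), (idx y).
- move=> a b; apply: (fiber_meas_subst S_sigma (g := fun g y => idx y g)) => //.
  exact: fiber_meas_comp2.
- move=> a; apply: (fiber_meas_subst S_sigma (g := fun g y => idx y g)) => //.
  exact: fiber_meas_comp.
- exact: idxm.
Qed.
End BorelFamily.

(** * Polish spaces of integer sequences *)

Local Open Scope ring_scope.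

Lemma exists_exp2V_lt (R : realType) (r : R) : 0 < r -> exists n, 2 ^- n < r.
Proof.
move=> r0; exists (Num.truncn r^-1).+1.
rewrite -[ltRHS]invrK ltf_pV2 ?posrE ?exprn_gt0 ?invr_gt0//.
apply: lt_trans (truncnS_gt _) _; rewrite -natrX ltr_nat.
exact: ltn_expl.
Qed.

(** The type X with the metric for which x and y are close when many coordinates of
    e x and e y agree. The injectivity of e is part of the name so that the metric
    structure can be inferred from it. *)
Definition coordinate_space (R : realType) (X : Type) (I : countType)
  (e : X -> I -> nat) (_ : injective e) : Type := X.

Section CoordinateMetric.
Variables (R : realType) (X : Type) (I : countType) (e : X -> I -> nat).
Hypothesis e_inj : injective e.

Definition agree (n : nat) (x y : X) : Prop :=
  forall i, (pickle i < n)%N -> e x i = e y i.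

Lemma agree_sym n x y : agree n x y -> agree n y x.
Proof. by move=> h i /h. Qed.

Lemma agree_trans n x y z : agree n x y -> agree n y z -> agree n x z.
Proof. by move=> h g i ni; rewrite h// g. Qed.

Lemma agree_le m n x y : (m <= n)%N -> agree n x y -> agree m x y.
Proof. by move=> mn h i im; apply: h; apply: leq_trans mn. Qed.

Lemma agree_all x y : (forall n, agree n x y) -> x = y.
Proof. by move=> h; apply: e_inj; apply/funext => i; apply: h (ltnSn _). Qed.

Let disagree_ex x y : x <> y -> exists n, ~~ `[<agree n x y>].
Proof.
move=> nxy; apply: contrapT => h; apply/nxy/agree_all => n.
by apply: contrapT => na; apply: h; exists n; apply/asboolPn.
Qed.

Definition first_disagree x y (nxy : x <> y) : nat := ex_minn (disagree_ex nxy).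

Definition agree_dist (x y : X) : R :=
  if pselect (x = y) is right nxy then 2 ^- first_disagree nxy else 0.

(** Balls are exactly agreement classes; every property of the metric is read off
    from this. *)
Lemma agree_dist_lt n x y : agree_dist x y < 2 ^- n <-> agree n x y.
Proof.
rewrite /agree_dist; case: pselect => [->|nxy].
  by split=> // _; rewrite invr_gt0 exprn_gt0.
rewrite /first_disagree; case: ex_minnP => m /asboolPn nm mmin.
rewrite ltf_pV2 ?posrE ?exprn_gt0// ltr_eXn2l ?ltr1n//; split=> [nm1|a].
  by apply: contrapT => /asboolPn/mmin; rewrite leqNgt nm1.
by rewrite ltnNge; apply/negP => mn; apply: nm; apply: agree_le a.
Qed.

Lemma agree_distxx x : agree_dist x x = 0.
Proof. by rewrite /agree_dist; case: pselect => // -[]. Qed.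

Lemma agree_dist_eq0 x y : agree_dist x y = 0 -> x = y.
Proof.
move=> d0; apply: agree_all => n; apply/agree_dist_lt.
by rewrite d0 invr_gt0 exprn_gt0.
Qed.

Lemma agree_dist_le x y (a : R) :
  0 <= a -> (forall n, a < 2 ^- n -> agree n x y) -> agree_dist x y <= a.
Proof.
move=> a0 h; have [->|nxy] := pselect (x = y); first by rewrite agree_distxx.
have dE : agree_dist x y = 2 ^- first_disagree nxy.
  by rewrite /agree_dist; case: pselect => // nxy'; rewrite (Prop_irrelevance nxy' nxy).
by rewrite leNgt dE; apply/negP => /h/agree_dist_lt; rewrite dE ltxx.
Qed.

Lemma agree_dist_sym x y : agree_dist x y = agree_dist y x.
Proof.
have ge0 u v : 0 <= agree_dist u v.
  by rewrite /agree_dist; case: pselect => // ?; rewrite invr_ge0 exprn_ge0.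
by apply/eqP; rewrite eq_le; apply/andP; split; apply: agree_dist_le => // n
  /agree_dist_lt/agree_sym.
Qed.

Lemma agree_dist_triangle y x z :
  agree_dist x z <= agree_dist x y + agree_dist y z.
Proof.
have ge0 u v : 0 <= agree_dist u v.
  by rewrite /agree_dist; case: pselect => // ?; rewrite invr_ge0 exprn_ge0.
apply: agree_dist_le; first exact: addr_ge0.
move=> n lt; apply: (@agree_trans _ _ y); apply/agree_dist_lt; apply: le_lt_trans lt.
  by rewrite lerDl.
by rewrite lerDr.
Qed.

HB.instance Definition _ := gen_eqMixin (@coordinate_space R X I e e_inj).
HB.instance Definition _ := gen_choiceMixin (@coordinate_space R X I e e_inj).
HB.instance Definition _ := isMetric.Build R (@coordinate_space R X I e e_inj)
  agree_distxx agree_dist_eq0 agree_dist_sym agree_dist_triangle.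

Local Notation M := (@coordinate_space R X I e e_inj).

Lemma coordinate_nbhsP (x : M) (A : set M) :
  nbhs x A <-> exists n, forall y, agree n x y -> A y.
Proof.
have ballE (z : M) r : ball z r = [set y : M | agree_dist z y < r].
  exact: (ballEmdist z r).
split=> [/nbhs_ballP[r /= r0 rA]|[n nA]]; last first.
  apply/nbhs_ballP; exists (2 ^- n); first by rewrite /= invr_gt0 exprn_gt0.
  by move=> y; rewrite ballE => /agree_dist_lt/nA.
have [n /ltW nr] := exists_exp2V_lt r0.
exists n => y /agree_dist_lt xy; apply: rA; rewrite ballE.
exact: lt_le_trans nr.
Qed.

Lemma coordinate_openP (A : set M) :
  open A <-> forall x, A x -> exists n, forall y, agree n x y -> A y.
Proof.
rewrite openE; split=> h x Ax; first exact/coordinate_nbhsP/h.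
exact/coordinate_nbhsP/h.
Qed.

Definition cylinder (l : seq (I * nat)) : set X :=
  [set x | forall p, p \in l -> e x p.1 = p.2].

Lemma coordinate_open_cylinders (A : set M) : open A ->
  A = (fun x : X => exists l : seq (I * nat), cylinder l `<=` A /\ cylinder l x).
Proof.
move=> /coordinate_openP oA; apply/seteqP; split=> [x Ax|x [l [lA lx]]]; last exact: lA.
have [n nA] := oA x Ax.
pose l := [seq (i, e x i) | i <- pmap (fun k => unpickle k : option I) (iota 0 n)].
exists l; split=> [y ly|p /mapP[i _ ->]//]; apply: nA => i ni.
suff /ly : (i, e x i) \in l by [].
apply/mapP; exists i => //; rewrite mem_pmap; apply/mapP; exists (pickle i).
  by rewrite mem_iota.
by rewrite pickleK.
Qed.

(** An open set is the union of the countably many cylinders that it contains. *)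
Lemma coordinate_borel_sub (T : set (set X)) : sigma_algebra setT T ->
  (forall i k, T (fun x => e x i = k)) -> @borel_sets M `<=` T.
Proof.
move=> Tsig Te; apply: smallest_sub => // A /coordinate_open_cylinders ->.
apply: meas_ex => // l; apply: meas_and => //; first exact: meas_const.
apply: (@meas_all _ _ Tsig (I * nat)%type) => p.
by apply: meas_imply => //; apply: meas_const.
Qed.

(** The range is sequentially closed for pointwise convergence in a discrete space,
    that is, closed in the Baire space. *)
Definition closed_range : Prop := forall (u : I -> nat) (x : nat -> X),
  (forall i, \forall n \near \oo, e (x n) i = u i) -> exists y, e y = u.

Lemma coordinate_polish : closed_range -> polish M.
Proof.
move=> cr; split.
  have /choice[p pP] (l : seq (I * nat)) : exists o : option X,
      if o is Some x then cylinder l x else forall x, ~ cylinder l x.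
    have [[x lx]|h] := pselect (exists x, cylinder l x); first by exists (Some x).
    by exists None => x lx; apply: h; exists x.
  exists (fun x : M => exists l, p l = Some x).
    have /choice[g gP] (x : X) : exists l, (exists m, p m = Some x) -> p l = Some x.
      have [[m mx]|h] := pselect (exists m, p m = Some x); first by exists m.
      by exists [::] => /h.
    apply/countable_injP; exists (fun x => pickle (g x)) => x y.
    rewrite !inE => /gP gx /gP gy /(pcan_inj pickleK) gxy.
    by move: gx; rewrite gxy gy => -[].
  move=> O [x Ox] /coordinate_open_cylinders OE; move: Ox; rewrite OE => -[l [lO lx]].
  case pl : (p l) (pP l) => [y|] ly; last by have := ly x.
  by exists y; split; [exists l|exists l].
move=> F FF /cauchyP Fc.
have /choice[x xP] n : exists x : M, F (fun y => agree n x y).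
  have [|x Fx] := Fc (2 ^- n); first by rewrite invr_gt0 exprn_gt0.
  exists x; apply: filterS Fx => y; rewrite (ballEmdist x) => h.
  exact/agree_dist_lt.
(* The i-th coordinate stabilises once enough coordinates agree. *)
pose u i := e (x (pickle i).+1) i.
have [|y yu] := cr u x.
  move=> i; near=> n.
  have [z [nz iz]] := filter_ex (filterI (xP n) (xP (pickle i).+1)).
  rewrite /u (nz i); last by near: n; exact: nbhs_infty_gt.
  by rewrite (iz i).
exists (y : M) => A /coordinate_nbhsP[n nA].
have Fn m : F (fun z => forall i : I, (pickle i < m)%N ->
    agree (pickle i).+1 (x (pickle i).+1) z).
  elim: m => [|m IH]; first by apply: filterS filterT.
  apply: filterS (filterI IH (xP m.+1)) => z [h hm] i.
  by rewrite ltnS leq_eqVlt => /orP[/eqP->//|]; apply: h.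
apply: filterS (Fn n) => z h; apply: nA => i ni; rewrite yu /u.
exact: (h i ni).
Unshelve. all: by end_near. Qed.

End CoordinateMetric.

Lemma coordinate_continuous (R : realType) (X X' : Type) (I I' : countType)
    (e : X -> I -> nat) (e' : X' -> I' -> nat) (ei : injective e) (ei' : injective e')
    (f : X' -> X) (j : I -> I') :
  (forall x i, e (f x) i = e' x (j i)) ->
  continuous (f : coordinate_space R ei' -> coordinate_space R ei).
Proof.
move=> fE x A /coordinate_nbhsP[n nA]; apply/coordinate_nbhsP.
exists (\max_(k < n) (if unpickle k is Some i then (pickle (j i)).+1 else 0))%N.
move=> y xy; apply: nA => i ni; rewrite !fE; apply: xy.
apply: leq_trans (leq_bigmax (Ordinal ni)).
by rewrite /= pickleK.
Qed.

Local Close Scope ring_scope.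

(** * The space of nilpotent groups of class two *)

Local Notation Z := (NiGp 2).

Definition noncommuting (G : group_structure) (n : nat) : Prop :=
  exists x y, pickle (x, y) = n /\ commutator G x y <> gone G.

Lemma first_noncommuting (G : Z) : exists n, noncommuting (set_val G) n /\
  forall m, noncommuting (set_val G) m -> (n <= m)%N.
Proof.
have [Gg /(nilpotent_class2P Gg)[_ [x [y nxy]]]] : Z (set_val G) by exact: set_valP.
have h : exists n, `[<noncommuting (set_val G) n>].
  by exists (pickle (x, y)); apply/asboolP; exists x, y.
exists (ex_minn h); case: ex_minnP => n /asboolP nn min; split=> // m /asboolP.
exact: min.
Qed.

(** The coordinate that makes the class exactly two a closed condition: groups of
    class at most two form a closed set, but a limit of noncommutative groups may be
    commutative unless a noncommuting pair is remembered. Taking the first such pair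
    makes it a function of the group. *)
Definition first_pair (G : Z) : nat := sval (cid (first_noncommuting G)).

Lemma first_pairE (G : Z) n : first_pair G = n <->
  noncommuting (set_val G) n /\ forall m, noncommuting (set_val G) m -> (n <= m)%N.
Proof.
rewrite /first_pair; case: cid => /= k [kG mk]; split=> [<-//|[nG mn]].
by apply/eqP; rewrite eqn_leq mk// mn.
Qed.

Definition coord : countType := ((nat * nat) + (nat + bool))%type.

Definition coords (G : Z) (i : coord) : nat :=
  match i with
  | inl (x, y) => gmul (set_val G) x y
  | inr (inl x) => ginv (set_val G) x
  | inr (inr b) => if b then gone (set_val G) else first_pair G
  end.

Lemma group_structure_eq (G H : group_structure) :
  gmul G =2 gmul H -> ginv G =1 ginv H -> gone G = gone H -> G = H.
Proof.
case: G H => [[m v] o] [[m' v'] o'] em ev eo.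
have -> : m = m' by apply/funext => -[x y]; exact: em.
have -> : v = v' by apply/funext => x; exact: ev.
by congr (_, _); apply: eo.
Qed.

Lemma coords_inj : injective coords.
Proof.
move=> G H e; have ei i : coords G i = coords H i by rewrite e.
apply: val_inj; apply: group_structure_eq => [x y|x|].
- exact: (ei (inl (x, y))).
- exact: (ei (inr (inl x))).
- exact: (ei (inr (inr true))).
Qed.

Lemma near_infty_eq (T : Type) (a b : nat -> T) (a0 b0 : T) :
  (\forall n \near \oo, a n = a0) -> (\forall n \near \oo, b n = b0) ->
  (forall n, a n = b n) -> a0 = b0.
Proof.
by move=> ha hb ab; have [n [<- <-]] := filter_ex (filterI ha hb).
Qed.

Section PointwiseLimit.
Variables (G : nat -> group_structure) (H : group_structure).
Hypothesis limM : forall x y, \forall n \near \oo, gmul (G n) x y = gmul H x y.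
Hypothesis limV : forall x, \forall n \near \oo, ginv (G n) x = ginv H x.
Hypothesis lim1 : \forall n \near \oo, gone (G n) = gone H.

Lemma near_gmul (a b : nat -> nat) (a0 b0 : nat) :
  (\forall n \near \oo, a n = a0) -> (\forall n \near \oo, b n = b0) ->
  \forall n \near \oo, gmul (G n) (a n) (b n) = gmul H a0 b0.
Proof.
move=> ha hb; apply: filterS (filterI (limM a0 b0) (filterI ha hb)) => n.
by case=> <- [-> ->].
Qed.

Lemma near_ginv (a : nat -> nat) (a0 : nat) : (\forall n \near \oo, a n = a0) ->
  \forall n \near \oo, ginv (G n) (a n) = ginv H a0.
Proof. by move=> ha; apply: filterS (filterI (limV a0) ha) => n [<- ->]. Qed.

Let near_cst (x : nat) : \forall n \near \oo, (fun=> x) n = x.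
Proof. exact: nearW. Qed.

Lemma near_commutator (a b : nat -> nat) (a0 b0 : nat) :
  (\forall n \near \oo, a n = a0) -> (\forall n \near \oo, b n = b0) ->
  \forall n \near \oo, commutator (G n) (a n) (b n) = commutator H a0 b0.
Proof. by move=> ha hb; do !(apply: near_gmul || apply: near_ginv). Qed.

Hypothesis Ggroup : forall n, is_group (G n).

Lemma limit_is_group : is_group H.
Proof.
split=> [x y z|x|x|x|x].
- apply: (near_infty_eq (a := fun n => gmul (G n) x (gmul (G n) y z))
    (b := fun n => gmul (G n) (gmul (G n) x y) z)) => [||n].
  + by do !apply: near_gmul.
  + by do !apply: near_gmul.
  + by have [] := Ggroup n.
- apply: (near_infty_eq (near_gmul lim1 (near_cst x)) (near_cst x)) => n.
  by have [] := Ggroup n.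
- apply: (near_infty_eq (near_gmul (near_cst x) lim1) (near_cst x)) => n.
  by have [] := Ggroup n.
- apply: (near_infty_eq (near_gmul (near_ginv (near_cst x)) (near_cst x)) lim1) => n.
  by have [] := Ggroup n.
- apply: (near_infty_eq (near_gmul (near_cst x) (near_ginv (near_cst x))) lim1) => n.
  by have [] := Ggroup n.
Qed.

Hypothesis Gnil : forall n, nilpotent_of_class (G n) 2.

Lemma limit_commutator x y z : commutator H (commutator H x y) z = gone H.
Proof.
apply: (near_infty_eq (near_commutator (near_commutator (near_cst x) (near_cst y))
  (near_cst z)) lim1) => n.
by have /(nilpotent_class2P (Ggroup n))[] := Gnil n.
Qed.

Lemma near_noncommuting m :
  \forall n \near \oo, noncommuting (G n) m <-> noncommuting H m.
Proof.
have [[[x y] xy]|h] := pselect (exists p : nat * nat, pickle p = m); last first.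
  by apply: nearW => n; split=> -[x [y [xy _]]]; case: h; exists (x, y).
have ncE K : noncommuting K m <-> commutator K x y <> gone K.
  split=> [[x' [y' [+ nc]]]|nc]; last by exists x, y.
  by rewrite -xy => /(pcan_inj pickleK)[<- <-].
apply: filterS (filterI (near_commutator (near_cst x) (near_cst y)) lim1) => n [cE oE].
by split=> /ncE nc; apply/ncE; move: nc; rewrite cE oE.
Qed.
End PointwiseLimit.

Lemma coords_closed : closed_range coords.
Proof.
move=> u G Gu; pose H : group_structure :=
  ((fun p => u (inl p), fun x => u (inr (inl x))), u (inr (inr true))).
have limM x y : \forall n \near \oo, gmul (set_val (G n)) x y = gmul H x y.
  exact: (Gu (inl (x, y))).
have limV x : \forall n \near \oo, ginv (set_val (G n)) x = ginv H x.
  exact: (Gu (inr (inl x))).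
have lim1 : \forall n \near \oo, gone (set_val (G n)) = gone H.
  exact: (Gu (inr (inr true))).
have GZ n : Z (set_val (G n)) by exact: set_valP.
have Gg n : is_group (set_val (G n)) := (GZ n).1.
have Gn n : nilpotent_of_class (set_val (G n)) 2 := (GZ n).2.
have Hg := limit_is_group limM limV lim1 Gg.
have limF := Gu (inr (inr false)).
have limN := near_noncommuting limM limV lim1.
have Hnc : noncommuting H (u (inr (inr false))).
  have [n [/first_pairE[nc _] ncE]] := filter_ex
    (filterI limF (limN (u (inr (inr false))))).
  exact/ncE.
have HZ : Z H.
  split=> //; apply/(nilpotent_class2P Hg); split.
    exact: limit_commutator limM limV lim1 Gg Gn.
  by have [x [y [_ nc]]] := Hnc; exists x, y.
exists (SigSub (mem_set HZ)); apply/funext => -[[x y]|[x|[]]] //.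
apply/first_pairE; split=> // m Hm.
have [n [/first_pairE[_ min] ncE]] := filter_ex (filterI limF (limN m)).
by apply: min; apply/ncE.
Qed.

Lemma nat_cvg (T : topologicalType) (f : T -> nat) (t : T) :
  (\forall s \near t, f s = f t) -> f @ t --> f t.
Proof.
move=> h A /nbhs_singleton Aft; suff : nbhs t (f @^-1` A) by [].
by apply: filterS h => s; rewrite /preimage /= => ->.
Qed.

Lemma ptws_nat_cvg (T U : topologicalType) (f : T -> {ptws U -> nat}) (t : T) :
  (forall u, \forall s \near t, f s u = f t u) -> f @ t --> f t.
Proof.
by move=> h; apply/pointwise_cvgP => u; apply: nat_cvg (fun s => f s u) t (h u).
Qed.

Lemma coords_family_measurable (Y : Type) (S : set (set Y)) (G : Y -> Z) :
  sigma_algebra setT S ->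
  (forall a b, fiber_measurable S (fun y => gmul (set_val (G y)) a b)) ->
  (forall a, fiber_measurable S (fun y => ginv (set_val (G y)) a)) ->
  fiber_measurable S (fun y => gone (set_val (G y))) ->
  forall i, fiber_measurable S (fun y => coords (G y) i).
Proof.
move=> Ss mM mV m1.
have mM2 a b : fiber_measurable S a -> fiber_measurable S b ->
    fiber_measurable S (fun y => gmul (set_val (G y)) (a y) (b y)).
  move=> ma mb.
  apply: (fiber_meas_subst Ss (g := fun i y => gmul (set_val (G y)) i (b y))) => // i.
  exact: (fiber_meas_subst Ss (g := fun j y => gmul (set_val (G y)) i j)).
have mC a b : fiber_measurable S (fun y => commutator (set_val (G y)) a b).
  by apply: (mM2) => //; apply: mM2.
have mN n : S (fun y => noncommuting (set_val (G y)) n).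
  apply: meas_ex => // a; apply: meas_ex => // b; apply: meas_and => //.
    exact: meas_const.
  apply: measN => //.
  apply: (meas_subst Ss (P := fun k y => commutator (set_val (G y)) a b = k)) => // k.
  exact: mC.
case=> [[a b]|[a|[]]] //= n.
rewrite [X in S X](_ : _ = fun y => noncommuting (set_val (G y)) n /\
  forall m, noncommuting (set_val (G y)) m -> (n <= m)%N).
  apply: meas_and => //; apply: meas_all => // m; apply: meas_imply => //.
  exact: meas_const.
by apply/funext => y; apply/propext/first_pairE.
Qed.

Section Topology.
Variable R : realType.
Local Notation M := (coordinate_space R coords_inj).

Lemma coordinate_near (G : M) (i : coord) : \forall H \near G, coords H i = coords G i.
Proof.
by apply/coordinate_nbhsP; exists (pickle i).+1 => H h; rewrite -h.
Qed.

Lemma set_val_coordinate_continuous :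
  continuous (fun G : M => set_val (G : Z) : group_structure).
Proof.
move=> G.
have cM : (fun H : M => (set_val (H : Z)).1.1) @ G --> (set_val (G : Z)).1.1.
  by apply: ptws_nat_cvg => -[x y]; exact: (coordinate_near G (inl (x, y))).
have cV : (fun H : M => (set_val (H : Z)).1.2) @ G --> (set_val (G : Z)).1.2.
  by apply: ptws_nat_cvg => x; exact: (coordinate_near G (inr (inl x))).
have c1 : (fun H : M => (set_val (H : Z)).2) @ G --> (set_val (G : Z)).2.
  by apply: nat_cvg; exact: (coordinate_near G (inr (inr true))).
have := cvg_pair (cvg_pair cM cV) c1.
rewrite (_ : (fun H => _) = (fun H : M => set_val (H : Z))); last first.
  by apply/funext => H; case: (set_val (H : Z)) => [[m v] o].
move=> h; rewrite /continuous_at (_ : set_val (G : Z) =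
  ((set_val (G : Z)).1.1, (set_val (G : Z)).1.2, (set_val (G : Z)).2)).
  by apply: h; typeclasses eauto.
by case: (set_val (G : Z)) => [[m v] o].
Qed.

Lemma open_coordinate_open (A : set Z) : open A -> @open M A.
Proof.
move=> [B oB <-]; have /continuousP := set_val_coordinate_continuous.
exact.
Qed.

Lemma coords_measurable i : fiber_measurable (@borel_sets Z) (fun G => coords G i).
Proof.
have Zs : sigma_algebra setT (@borel_sets Z) by exact: smallest_sigma_algebra.
have cont (T : topologicalType) (f : group_structure -> T) (A : set T) :
    continuous f -> open A -> @borel_sets Z (fun G => A (f (set_val G))).
  move=> cf oA; apply: sub_sigma_algebra; exists (f @^-1` A) => //.
  by move/continuousP: cf; apply.
have mM x y : fiber_measurable (@borel_sets Z) (fun G => gmul (set_val G) x y).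
  move=> k; apply: (cont nat (fun K => K.1.1 (x, y)) [set k]); last exact: discrete_open.
  move=> K.
  apply: (@continuous_comp _ _ _ (fun K : group_structure => K.1.1) (proj (x, y))).
    by apply: continuous_comp; apply: cvg_fst.
  exact: proj_continuous.
have mV x : fiber_measurable (@borel_sets Z) (fun G => ginv (set_val G) x).
  move=> k; apply: (cont nat (fun K => K.1.2 x) [set k]); last exact: discrete_open.
  move=> K; apply: (@continuous_comp _ _ _ (fun K : group_structure => K.1.2) (proj x)).
    by apply: continuous_comp; [apply: cvg_fst|apply: cvg_snd].
  exact: proj_continuous.
have m1 : fiber_measurable (@borel_sets Z) (fun G => gone (set_val G)).
  move=> k; apply: (cont nat (fun K => K.2) [set k]); last exact: discrete_open.
  by move=> K; apply: cvg_snd.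
exact: coords_family_measurable.
Qed.

Lemma NiGp2_borel_iso : borel_isomorphism (@borel_sets Z) (id : Z -> M).
Proof.
have Zs : sigma_algebra setT (@borel_sets Z) by exact: smallest_sigma_algebra.
split; first by exists id.
move=> B; split.
  exact: (coordinate_borel_sub Zs coords_measurable).
apply: sub_sigma_algebra2 => A; exact: open_coordinate_open.
Qed.

Lemma NiGp2_polish : polish M.
Proof. exact: (@coordinate_polish R _ _ _ coords_inj coords_closed). Qed.
End Topology.

Definition proper_embedding (t : Z * (nat -> nat) * nat) : Prop :=
  [/\ {morph t.1.2 : x y / gmul (set_val t.1.1) x y}, injective t.1.2 &
    forall x, t.1.2 x <> t.2].

Definition embedding_coords (t : {t | proper_embedding t})
    (i : coord + option nat) : nat :=
  match i with
  | inl i => coords (sval t).1.1 i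
  | inr (Some x) => (sval t).1.2 x
  | inr None => (sval t).2
  end.

Lemma embedding_coords_inj : injective embedding_coords.
Proof.
move=> [[[G f] y] Pt] [[[G' f'] y'] Pt'] e.
have ei i : embedding_coords (exist _ (G, f, y) Pt) i =
    embedding_coords (exist _ (G', f', y') Pt') i by rewrite e.
apply: eq_exist; congr (_, _, _).
- by apply: coords_inj; apply/funext => i; apply: (ei (inl i)).
- by apply/funext => x; apply: (ei (inr (Some x))).
- exact: (ei (inr None)).
Qed.

Lemma embedding_coords_closed : closed_range embedding_coords.
Proof.
move=> u t tu.
have [G Gu] := coords_closed (u := fun i => u (inl i))
  (x := fun n => (sval (t n)).1.1) (fun i => tu (inl i)).
pose f x := u (inr (Some x)); pose y := u (inr None).
have limf x : \forall n \near \oo, (sval (t n)).1.2 x = f x by exact: (tu (inr (Some x))).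
have limy : \forall n \near \oo, (sval (t n)).2 = y by exact: (tu (inr None)).
have limM a b : \forall n \near \oo,
    gmul (set_val (sval (t n)).1.1) a b = gmul (set_val G) a b.
  have -> : gmul (set_val G) a b = u (inl (inl (a, b))).
    by have := congr1 (fun c => c (inl (a, b))) Gu.
  exact: (tu (inl (inl (a, b)))).
have Pt : proper_embedding (G, f, y).
  split=> [a b|a b|x] /=.
  - have [n [[[e1 e2] [e3 e4]] e5]] := filter_ex (filterI
      (filterI (filterI (limM a b) (limf (gmul (set_val G) a b)))
        (filterI (limf a) (limf b))) (limM (f a) (f b))).
    by have [+ _ _] := svalP (t n) => /(_ a b); rewrite e1 e2 e3 e4 e5.
  - move=> fab; have [n [ea eb]] := filter_ex (filterI (limf a) (limf b)).
    by have [_ + _] := svalP (t n); apply; rewrite ea eb.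
  - have [n [ea eb]] := filter_ex (filterI (limf x) limy).
    by have [_ _ /(_ x)] := svalP (t n); rewrite ea eb.
exists (exist _ _ Pt); apply/funext => -[i|[x|]] //=.
by rewrite Gu.
Qed.

(** The complement is the projection of the Polish space of proper embeddings. *)
Lemma co_hopfian_coanalytic (R : realType) :
  coanalytic R (@borel_sets Z) [set G : Z | co_hopfian (set_val G)].
Proof.
exists (coordinate_space R coords_inj), id; split.
- exact: NiGp2_polish.
- exact: NiGp2_borel_iso.
exists (coordinate_space R embedding_coords_inj), (fun t => (sval t).1.1); split.
- exact: (@coordinate_polish R _ _ _ embedding_coords_inj embedding_coords_closed).
- exact: (coordinate_continuous (j := inl)).
rewrite image_id; apply/seteqP; split=> [_ [[[[G f] y] [/= fM fI fy]] _ <-]|G /=].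
  by move=> /= /(_ f fM fI y) [x]; apply: fy.
move=> h; apply: contrapT => hG; apply: h => f fM fI y.
apply: contrapT => hy; apply: hG.
have Pt : proper_embedding (G, f, y) by split=> // x fx; apply: hy; exists x.
by exists (exist _ _ Pt).
Qed.

(** * Co-analytic sets and infinite paths *)

Local Open Scope ring_scope.

Lemma borel_isomorphism_sigma (Y : Type) (S : set (set Y)) (T : topologicalType)
  (h : Y -> T) : borel_isomorphism S h -> sigma_algebra setT S.
Proof.
move=> [[g hK gK] hS].
have SE B : S B <-> @borel_sets T (g @^-1` B).
  rewrite hS (_ : h @^-1` _ = B)//; apply/seteqP; split=> y; rewrite /preimage /= hK//.
have [T0 TD TU] : sigma_algebra setT (@borel_sets T) by exact: smallest_sigma_algebra.
split=> [|A /SE SA|A SA]; apply/SE.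
- by rewrite preimage_set0.
- by have := TD _ SA; rewrite !setTD.
- by rewrite preimage_bigcup; apply: TU => n; apply/SE.
Qed.

Lemma standard_borel_sigma (R : realType) (Y : Type) (S : set (set Y)) :
  standard_borel R S -> sigma_algebra setT S.
Proof. by move=> [M [h [_ /borel_isomorphism_sigma]]]. Qed.

(** The values are optional because N may be empty. *)
Lemma dense_enumeration (R : realType) (N : metricType R) (D : set N) :
  countable D -> dense D -> exists c : nat -> option N,
  forall (z : N) (r : R), 0 < r -> exists n x, c n = Some x /\ mdist x z < r.
Proof.
move=> /countable_injP[g g_inj] D_dense.
have /choice[c cP] n : exists o : option N,
    forall x, D x -> g x = n -> o = Some x.
  have [[x [Dx gx]]|h] := pselect (exists x, D x /\ g x = n).
    exists (Some x) => x' Dx' gx'; congr Some; apply: g_inj; rewrite ?inE//.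
    by rewrite gx gx'.
  by exists None => x Dx gx; case: h; exists x.
exists c => z r r0.
have [|x [/interior_subset zx Dx]] := D_dense (ball z r)^° _ (open_interior _).
  by exists z; apply: nbhsx_ballx.
move: zx; rewrite ballEmdist /= => zx.
by exists (g x), x; rewrite (cP _ x)// metric_sym.
Qed.

(** A co-analytic set is given by a fixed order on the natural numbers and a
    measurable family of subsets in which one looks for infinite paths. The nodes are
    the balls of radius 2^-n around the points of a countable dense set of N,
    ordered by formal inclusion. Node k is allowed at y when f sends some point of
    the ball within 2^-n of h y. An infinite path converges to a point z, with
    f z = h y by continuity; conversely the balls shrinking to z form a path. *)
Lemma coanalytic_paths (R : realType) (Y : Type) (S : set (set Y)) (B : set Y) :
  coanalytic R S B ->
  exists (lev : nat -> nat) (ord : nat -> nat -> Prop) (P : nat -> set Y),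
  [/\ forall k l m, ord k l -> ord l m -> ord k m,
      forall k l, ord k l -> (lev k < lev l)%N,
      forall k, S (P k)
    & forall y, ~ B y <->
        exists s : nat -> nat, forall n, ord (s n) (s n.+1) /\ P (s n) y].
Proof.
move=> [M [h [_ [h_bij hS] [N [f [[[D Dc Dd] N_complete] f_cont f_range]]]]]].
have [c cP] := dense_enumeration Dc Dd.
(* Node k codes the formal ball of centre pt k and radius rad k. *)
pose lev k : nat :=
  if (unpickle k : option (nat * nat)) is Some (n, _) then n else 0%N.
pose pt k : option N :=
  if (unpickle k : option (nat * nat)) is Some (_, a) then c a else None.
pose rad k : R := 2 ^- lev k.
have rad0 k : 0 < rad k by rewrite invr_gt0 exprn_gt0.
pose ord k l := (lev k < lev l)%N /\ exists a b, [/\ pt k = Some a, pt l = Some b &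
  mdist a b + rad l <= rad k].
pose P k := [set y | exists a z, [/\ pt k = Some a, mdist a z <= rad k &
  mdist (f z) (h y) < rad k]].
exists lev, ord, P; split.
- move=> k l m [kl [a [b [ka lb ab]]]] [lm [b' [d [lb' md bd]]]]; split.
    exact: ltn_trans lm.
  exists a, d; split=> //; move: lb'; rewrite lb => -[bb']; subst b'.
  by have := metric_triangle a b d; lra.
- by move=> k l [].
- move=> k; rewrite (_ : P k = h @^-1` [set m | exists a z,
    [/\ pt k = Some a, mdist a z <= rad k & mdist (f z) m < rad k]])//.
  apply/hS; apply: sub_sigma_algebra; rewrite openE => m [a [z [ka az zm]]].
  apply/nbhs_ballP; exists (rad k - mdist (f z) m); first by rewrite /= subr_gt0.
  move=> m'; rewrite ballEmdist /= => mm'; exists a, z; split=> //.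
  by have := metric_triangle (f z) m m'; lra.
move=> y; split=> [nBy|[s sP]].
  have [z0 _ fz0] : range f (h y) by rewrite f_range; exists y.
  have /choice[a aP] n : exists a x, c a = Some x /\ mdist x z0 < 2 ^- n.+2.
    by apply: cP; rewrite invr_gt0 exprn_gt0.
  pose s n : nat := pickle (n, a n).
  have levs n : lev (s n) = n by rewrite /lev /s pickleK.
  have ptsE n : exists2 x, pt (s n) = Some x & mdist x z0 < 2 ^- n.+2.
    by rewrite /pt /s pickleK; have [x [cx xz]] := aP n; exists x.
  exists s => n; have [x nx xz] := ptsE n; have [x' nx' xz'] := ptsE n.+1.
  have e m : 2 ^- m = 2 * 2 ^- m.+1 :> R.
    by rewrite exprS invfM mulrA divff ?mul1r// pnatr_eq0.
  have p3 : 0 < 2 ^- n.+3 :> R by rewrite invr_gt0 exprn_gt0.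
  split.
    split; first by rewrite !levs.
    exists x, x'; split=> //; rewrite /rad !levs.
    have := metric_triangle x z0 x'; rewrite (metric_sym z0).
    by move: xz xz'; rewrite (e n) (e n.+1) (e n.+2); lra.
  exists x, z0; split=> //; rewrite /rad levs.
    by move: xz; rewrite (e n) (e n.+1) (e n.+2); lra.
  by rewrite fz0 mdistxx invr_gt0 exprn_gt0.
have /choice[a aP] n : exists a, pt (s n) = Some a.
  by have [[_ [a [b [an _ _]]]] _] := sP n; exists a.
have /choice[z zP] n : exists z,
    mdist (a n) z <= rad (s n) /\ mdist (f z) (h y) < rad (s n).
  by have [_ [a' [z [+ az fz]]]] := sP n; rewrite aP => -[aa']; exists z; rewrite aa'.
have step n : mdist (a n) (a n.+1) + rad (s n.+1) <= rad (s n).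
  have [[_ [a1 [a2 [+ + le12]]]] _] := sP n.
  by rewrite !aP => -[a1E] [a2E]; rewrite a1E a2E.
have dist_le m n : mdist (a m) (a (m + n)%N) + rad (s (m + n)%N) <= rad (s m).
  elim: n => [|n IH]; first by rewrite addn0 mdistxx add0r.
  have := step (m + n)%N; rewrite addnS.
  have := metric_triangle (a m) (a (m + n)%N) (a (m + n).+1); lra.
have lev_ge n : (n <= lev (s n))%N.
  elim: n => // n IH; have [[lt _] _] := sP n; exact: leq_ltn_trans lt.
have rad_le n : rad (s n) <= 2 ^- n.
  by rewrite lef_pV2 ?posrE ?exprn_gt0// ler_eXn2l// ltr1n.
have rad_lt (r : R) : 0 < r -> \forall n \near \oo, rad (s n) < r.
  move=> r0; have [m mr] := exists_exp2V_lt r0; near=> n.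
  apply: le_lt_trans mr; apply: le_trans (rad_le n) _.
  rewrite lef_pV2 ?posrE ?exprn_gt0// ler_eXn2l ?ltr1n//.
  by near: n; exact: nbhs_infty_ge.
have ac : cauchy (a @ \oo).
  apply: cauchy_exP => r r0.
  have [m mr] := filter_ex (rad_lt r r0).
  exists (a m); suff : \forall n \near \oo, ball (a m) r (a n) by [].
  near=> n; rewrite ballEmdist /=.
  have mn : (m <= n)%N by near: n; exact: nbhs_infty_ge.
  have := dist_le m (n - m)%N; rewrite subnKC//.
  by have := rad0 (s n); lra.
have [z1 az1] := N_complete (a @ \oo) _ ac.
have zz1 : z @ \oo --> z1.
  move=> A /nbhs_ballP[r /= r0 rA]; suff : \forall n \near \oo, A (z n) by [].
  have r20 : 0 < r / 2 by rewrite divr_gt0.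
  have azr : \forall n \near \oo, ball z1 (r / 2) (a n) := az1 _ (nbhsx_ballx z1 _ r20).
  near=> n; apply: rA; rewrite ballEmdist /=.
  have : ball z1 (r / 2) (a n) by near: n; exact: azr.
  rewrite ballEmdist /=; have : rad (s n) < r / 2 by near: n; exact: rad_lt.
  by have [+ _] := zP n; have := metric_triangle z1 (a n) (z n); lra.
have fz1 : f z1 = h y.
  apply: (@mdist_positivity R M); apply/eqP; rewrite eq_le mdist_ge0 andbT.
  apply/ler_addgt0Pl => r r0; rewrite addr0.
  have r20 : 0 < r / 2 by rewrite divr_gt0.
  have fzz1 : \forall n \near \oo, ball (f z1) (r / 2) (f (z n)).
    exact: zz1 _ (f_cont _ _ (nbhsx_ballx (f z1) _ r20)).
  have := filter_ex (filterI fzz1 (rad_lt _ r20)).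
  move=> [n [/=]]; rewrite ballEmdist /= => d1 d2.
  have [_ d3] := zP n; have := metric_triangle (f z1) (f (z n)) (h y); lra.
have : (h @` (~` B)) (h y) by rewrite -f_range -fz1; exists z1.
by move=> [y' nBy' /(bij_inj h_bij) <-].
Unshelve. all: by end_near. Qed.

Local Close Scope ring_scope.

(** * The reduction *)

(** The relation [D y] is the fixed order restricted to the nodes allowed at y, made
    reflexive. *)
Lemma co_hopfian_hard (R : realType) (Y : Type) (S : set (set Y)) (B : set Y) :
  standard_borel R S -> coanalytic R S B ->
  exists F : Y -> NiGp 2, borel_function S (@borel_sets (NiGp 2)) F /\
    B = F @^-1` [set G : NiGp 2 | co_hopfian (set_val G)].
Proof.
move=> /standard_borel_sigma Ss.
move=> /coanalytic_paths[lev [ord [P [ord_trans ord_lev P_meas BP]]]].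
pose D y a b := a = b \/ [/\ ord a b, P a y & P b y].
have Dm a b : S (fun y => D y a b).
  have [->|ab] := pselect (a = b).
    rewrite [X in S X](_ : _ = fun=> True); first exact: meas_const.
    by apply/seteqP; split=> y // _; left.
  rewrite [X in S X](_ : _ = fun y => ord a b /\ (P a y /\ P b y)).
    by apply: meas_and => //; [apply: meas_const|apply: meas_and].
  apply/seteqP; split=> y; first by case=> [//|[? ? ?]].
  by move=> [? [? ?]]; right.
have [G [GE mM mV m1]] := borel_group_family Ss Dm.
have GZ y : NiGp 2 (G y).
  have [en [idx [-> [idxE enK]]]] := GE y.
  by split; [apply: enumerated_is_group|apply: enumerated_nilpotent2].
have chP y : co_hopfian (G y) <-> B y.
  have [en [idx [-> [idxE enK]]]] := GE y.
  rewrite (enumerated_co_hopfian_path idxE enK (lev := lev)); first last.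
  - by move=> a b [//|[ab _ _] _]; apply: ord_lev.
  - move=> a b c [->//|[ab Pa Pb]] [<-|[bc _ Pc]]; first by right.
    by right; split=> //; apply: ord_trans bc.
  - by move=> a; left.
  split=> [h|By [s sD]].
    apply: contrapT => /BP[s sP]; apply: h; exists s => n.
    have [lt Pn] := sP n; have [_ Pn1] := sP n.+1; split; first by right.
    by move=> e; have := ord_lev _ _ lt; rewrite -e ltnn.
  apply: ((BP y).2 _ By); exists s => n.
  by case: (sD n) => -[e ne|[lt Pn _] _]; [case: (ne e)|split].
pose F y : NiGp 2 := SigSub (mem_set (GZ y)).
exists F; split; last by apply/seteqP; split=> y /chP.
have Fm := @coords_family_measurable Y S F Ss mM mV m1.
move=> A /(NiGp2_borel_iso R).2.
move: A; apply: (@coordinate_borel_sub R _ _ _ coords_inj (fun A => S (F @^-1` A))) => //.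
case: Ss => S0 SD SU; split=> [|A SA|A SA].
- by rewrite preimage_set0.
- by rewrite setTD preimage_setC -setTD; apply: SD.
- by rewrite preimage_bigcup; apply: SU.
Qed.

Theorem theorem1p6 (R : realType) :
  complete_coanalytic R (@borel_sets (NiGp 2))
    [set G : NiGp 2 | co_hopfian (set_val G)]%classic.
Proof.
split; [|exact: co_hopfian_coanalytic|exact: co_hopfian_hard].
exists (coordinate_space R coords_inj), id.
by split; [apply: NiGp2_polish|apply: NiGp2_borel_iso].
Qed.
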